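(* Let $d\ge1$ and let $(V_\gamma)_{\gamma>0}$ be a family of i.i.d. non-negative potentials $V_\gamma=(V_\gamma(x))_{x\in\mathbb{Z}^d}$. Assume that $V_\gamma(0)/\gamma$ converges in distribution as $\gamma\searrow0$ to some random variable $V$ and that $\mathbb{E}[V_\gamma(0)]/\gamma\in(0,\infty)$ converges to $\mathbb{E}[V]\in[0,\infty]$ as $\gamma\searrow0$. Then for all $\ell\in\mathbb{R}^d$, $$\lim_{\gamma\searrow0}\frac{\alpha_{V_\gamma}(\ell)}{\sqrt{\gamma}}=\lim_{\gamma\searrow0}\frac{\beta_{V_\gamma}(\ell)}{\sqrt{\gamma}}=\sqrt{2d\,\mathbb{E}[V]}\ \|\ell\|_2 .$$
   Context: For each fixed $\gamma>0$ the random variables $V_\gamma(x)$, $x\in\mathbb{Z}^d$, are i.i.d. under a probability measure $\mathbb{P}$ with expectation $\mathbb{E}$. The limit $V$ is a single (real-valued, non-negative) random variable and $\mathbb{E}[V]$ is its expectation. The condition $\mathbb{E}[V_\gamma(0)]/\gamma\in(0,\infty)$ is for all $\gamma>0$. Let $(S(n))_{n\ge0}$ be the symmetric nearest-neighbor random walk on $\mathbb{Z}^d$ started at $0$, defined on a different probability space with measure $P$ and expectation $E$, and let $H(y)=\inf\{n\ge0\mid S(n)=y\}$. For a potential $U=(U(x))_{x\in\mathbb{Z}^d}$ of i.i.d. non-negative random variables with $\mathbb{P}[U(0)>0]>0$ put $$e(0,y,U)=E\Big[\exp\Big(-\sum_{n=0}^{H(y)-1}U(S(n))\Big)\mathbf{1}_{H(y)<\infty}\Big],\qquad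 y\in\mathbb{Z}^d.$$ Quenched Lyapunov exponent: if $\mathbb{E}[U(0)]<\infty$, it is known that there is a (unique) non-random norm $\alpha_U$ on $\mathbb{R}^d$ such that $\mathbb{P}$-a.s. for all $\ell\in\mathbb{Z}^d$, $$\alpha_U(\ell)=\lim_{k\to\infty}\frac{-\ln e(0,k\ell,U)}{k}=\lim_{k\to\infty}\frac{-\mathbb{E}[\ln e(0,k\ell,U)]}{k}.$$ Annealed Lyapunov exponent: it is known that there is a (unique) norm $\beta_U$ on $\mathbb{R}^d$ such that for all $\ell\in\mathbb{Z}^d$, $$\beta_U(\ell)=\lim_{k\to\infty}\frac{-1}{k}\ln\mathbb{E}[e(0,k\ell,U)].$$ Conventions: $\sqrt{\infty}=\infty$ and $\infty\cdot0=0$. *)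

(* Defs.v *)
From HB Require Import structures.
From mathcomp Require Import all_boot all_order all_algebra finmap.
From mathcomp Require Import all_classical all_reals all_analysis.

Set Implicit Arguments.
Unset Strict Implicit.
Unset Printing Implicit Defensive.

Import Order.TTheory GRing.Theory Num.Theory.
Import numFieldNormedType.Exports.

Local Open Scope classical_set_scope.
Local Open Scope ring_scope.

(* The family (X i)_i is mutually independent with respect to the collection
   G of measurable sets of the target type E. *)
Definition mutually_independent (dO : measure_display)
    (Omega : measurableType dO) (R : realType) (P : probability Omega R)
    (I : choiceType) (E : Type) (G : set (set E)) (X : I -> Omega -> E) :=
  forall (J : {fset I}) (B : I -> set E), (forall i, i \in J -> G (B i)) ->
    P (\bigcap_(i in [set` J]) (X i @^-1` B i)) =
    (\prod_(i <- J) P (X i @^-1` B i))%E.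

Definition iid_potential (dO : measure_display) (Omega : measurableType dO)
    (R : realType) (P : probability Omega R) (d : nat)
    (U : 'rV[int]_d -> {RV P >-> R}) :=
  [/\ forall x w, 0 <= U x w,
      mutually_independent P measurable (fun x => U x : Omega -> R) &
      forall x (B : set R), measurable B ->
        distribution P (U x) B = distribution P (U 0) B].

Definition neighbor_of_origin (d : nat) (z : 'rV[int]_d) : bool :=
  (\sum_(i < d) `|z 0%R i|)%N == 1%N.

(* 'rV[int]_d carries the discrete sigma-algebra, hence the collection setT
   of all subsets in the independence of the increments. *)
Definition simple_random_walk (dO : measure_display)
    (Omega : measurableType dO) (R : realType) (Q : probability Omega R)
    (d : nat) (S : nat -> Omega -> 'rV[int]_d) :=
  [/\ forall n z, measurable [set w | S n w = z],
      forall w, S 0%N w = 0,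
      mutually_independent Q setT (fun n w => S n.+1 w - S n w) &
      forall n z, Q [set w | S n.+1 w - S n w = z] =
        (if neighbor_of_origin z then (2 * d)%N%:R^-1 else 0)%:E].

(* None stands for an infinite hitting time. *)
Definition hitting_time (d : nat) (s : nat -> 'rV[int]_d) (y : 'rV[int]_d) :
    option nat :=
  if pselect (exists n, s n == y) is left h then Some (ex_minn h) else None.

(* e(0,y,u) for a fixed realization u of the potential.  The integrand takes
   values in [0, 1], so nothing is lost in applying fine. *)
Definition survival (dO : measure_display) (Omega : measurableType dO)
    (R : realType) (Q : probability Omega R) (d : nat)
    (S : nat -> Omega -> 'rV[int]_d) (u : 'rV[int]_d -> R) (y : 'rV[int]_d) :
    R :=
  fine 'E_Q[fun w => if hitting_time (S ^~ w) y is Some h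
                     then expR (- \sum_(n < h) u (S n w)) else 0].

Definition is_norm (R : realType) (d : nat) (N : 'rV[R]_d -> R) :=
  [/\ forall x, N x = 0 -> x = 0,
      forall (c : R) x, N (c *: x) = `|c| * N x &
      forall x y, N (x + y) <= N x + N y].

Definition int_vec (R : realType) (d : nat) (l : 'rV[int]_d) : 'rV[R]_d :=
  map_mx (fun m : int => m%:~R) l.

(* "The norm a is the quenched Lyapunov exponent of U": at most one norm
   satisfies these limit relations, since they determine it on integer
   vectors.  "annealed_lyapunov" is to be read likewise. *)
Definition quenched_lyapunov (dO dW : measure_display)
    (Omega : measurableType dO) (W : measurableType dW) (R : realType)
    (P : probability Omega R) (Q : probability W R) (d : nat)
    (S : nat -> W -> 'rV[int]_d) (U : 'rV[int]_d -> Omega -> R)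
    (a : 'rV[R]_d -> R) :=
  [/\ is_norm a,
      {ae P, forall w, forall l : 'rV[int]_d,
        - ln (survival Q S (U ^~ w) (l *+ k)) / k%:R @[k --> \oo]
          --> a (int_vec R l)} &
      forall l : 'rV[int]_d,
        ((- k%:R^-1)%:E *
           'E_P[fun w => ln (survival Q S (U ^~ w) (l *+ k))%R])%E
          @[k --> \oo] --> (a (int_vec R l))%:E].

Definition annealed_lyapunov (dO dW : measure_display)
    (Omega : measurableType dO) (W : measurableType dW) (R : realType)
    (P : probability Omega R) (Q : probability W R) (d : nat)
    (S : nat -> W -> 'rV[int]_d) (U : 'rV[int]_d -> Omega -> R)
    (b : 'rV[R]_d -> R) :=
  is_norm b /\
  forall l : 'rV[int]_d,
    - k%:R^-1 * ln (fine 'E_P[fun w => survival Q S (U ^~ w) (l *+ k)])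
      @[k --> \oo] --> b (int_vec R l).

Definition cvg_in_distribution_at0 (dO dO' : measure_display)
    (Omega : measurableType dO) (Omega' : measurableType dO') (R : realType)
    (P : probability Omega R) (P' : probability Omega' R)
    (X : R -> Omega -> R) (Y : Omega' -> R) :=
  forall f : R -> R, continuous f -> (exists M : R, forall t, `|f t| <= M) ->
    'E_P[f \o X g]%E @[g --> 0^'+] --> 'E_P'[f \o Y]%E.

(* The norm `|x| of the library on 'rV[R]_d is the sup norm. *)
Definition norm2 (R : realType) (d : nat) (x : 'rV[R]_d) : R :=
  Num.sqrt (\sum_(i < d) x 0 i ^+ 2).

(* Main.v *)
(* Upper bound. Restricting the walk to a step law [q] with mean [v] and using
   concavity of the logarithm, [a(y) = - E ln e(0, y, U)] satisfies
   [a(y) <= E U(0) + KL(q) + sum_s q(s) a(y - s)], where [KL(q)] is the entropy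
   of [q] relative to the uniform step law. Iterating along multiples of [v]
   gives [alpha(v) <= E U(0) + KL(q)] with [KL(q) ~ d |v|^2 / 2], and optimising
   over the length of [v] gives [sqrt(2 d E U(0)) |v|]. Jensen's inequality
   gives [beta <= alpha].

   Lower bound. After truncation and discretisation, averaging over the
   environment charges a path at least [lam * sum_x min(local time at x, N)] with
   [lam ~ gamma E V] and [N ~ delta / gamma]. Cut space into slabs of width
   [L = K / sqrt(gamma)] orthogonal to the direction [e], and charge between two
   successive first passages only the sites of the slab being crossed. The cost
   of a crossing is then independent of the past. Were no site visited [N] times,
   a crossing would weigh at most [1 / cosh(sqrt(2 d lam) (L - 1))]; and the
   number of visits to a site before the exit has a geometric tail of mean
   [O(L)], much smaller than [N], so that saturation is negligible as [gamma]
   tends to 0. Both facts are expressed by one explicit superharmonic function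
   of the path history, so that no path measure is needed. *)
Require Import Defs.
From HB Require Import structures.
From mathcomp Require Import all_boot all_order all_algebra finmap.
From mathcomp Require Import all_classical all_reals all_analysis.
From mathcomp Require Import measurable_realfun.
From mathcomp Require Import ring lra zify.

Set Implicit Arguments.
Unset Strict Implicit.
Unset Printing Implicit Defensive.

Import Order.TTheory GRing.Theory Num.Theory.
Import numFieldNormedType.Exports.

Local Open Scope classical_set_scope.
Local Open Scope ring_scope.


(** * Calculus *)

(** Only two one-sided estimates are needed: an upper bound for [alpha] and a lower bound for
    [beta]; the inequality [beta <= alpha] then squeezes both. The upper bound sees the potential
    through its mean, the lower bound through E min(V_gamma(0)/gamma, M), because convergence in
    distribution controls bounded continuous functions. Both exponents are given by limits on
    integer vectors only; real vectors x are reached by rounding p x, since rounding costs a bounded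
    amount while the norm grows like p.

    Capping local times at N comes from the linearisation exp(-t) <= 1 - (1 - delta) t, valid for 0
    <= t <= delta <= 1, whence N gamma M <= delta. K must be large because 1/cosh carries a
    prefactor 2, to be absorbed by an arbitrarily small loss in the exponential rate. The tail has
    rate of order 1/L, that is sqrt(gamma), and runs for N ~ delta/(gamma M) visits: it is
    exp(-const/sqrt(gamma)), smaller than any power of gamma, while the number of sites in play is
    at most of order L^2 ~ 1/gamma. The constants are fixed in the order M, mesh, delta, K, and
    gamma last. *)

Definition cosh (R : realType) (x : R) : R := (expR x + expR (- x)) / 2.

Lemma derive_ge0_ge0 (R : realType) (f df : R -> R) (x : R) : 0 <= x ->
  (forall y : R, is_derive y (1 : R) f (df y)) -> (forall y, 0 <= y -> 0 <= df y) ->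
  f 0 = 0 -> 0 <= f x.
Proof.
move=> x0 fdf df0 f0.
have [|c cx] := @MVT_segment R f df 0 x x0 (fun y _ => fdf y).
  by apply: derivable_within_continuous => y _; exact: ex_derive.
rewrite f0 !subr0 => ->; apply: mulr_ge0 => //; apply: df0.
by move: cx; rewrite in_itv /= => /andP[].
Qed.

Lemma expR_opp_add_ge2 (R : realType) (x : R) : 2 <= expR x + expR (- x).
Proof. by have := expR_ge1Dx x; have := expR_ge1Dx (- x); lra. Qed.

Lemma sinh_ge_id (R : realType) (x : R) : 0 <= x -> 2 * x <= expR x - expR (- x).
Proof.
move=> x0; rewrite -subr_ge0.
apply: (@derive_ge0_ge0 _ (fun x => expR x - expR (- x) - 2 * x)
  (fun x => expR x + expR (- x) - 2)) => //.
- by move=> y; apply: is_derive_eq; rewrite /GRing.scale /=; ring.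
- by move=> y _; have := expR_opp_add_ge2 y; lra.
- by rewrite oppr0 expR0; ring.
Qed.

Lemma sinh_le_mul_cosh (R : realType) (x : R) :
  0 <= x -> expR x - expR (- x) <= x * (expR x + expR (- x)).
Proof.
move=> x0; rewrite -subr_ge0.
apply: (@derive_ge0_ge0 _
  (fun x => x * (expR x + expR (- x)) - (expR x - expR (- x)))
  (fun x => x * (expR x - expR (- x)))) => //.
- by move=> y; apply: is_derive_eq; rewrite /GRing.scale /=; ring.
- move=> y y0; apply: mulr_ge0 => //.
  by have := sinh_ge_id y0; lra.
- by rewrite oppr0 expR0; ring.
Qed.

Lemma coshN (R : realType) (x : R) : cosh (- x) = cosh x.
Proof. by rewrite /cosh opprK addrC. Qed.

Lemma cosh0 (R : realType) : cosh (0 : R) = 1.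
Proof. by rewrite /cosh oppr0 expR0; field. Qed.

Lemma cosh_ge1 (R : realType) (x : R) : 1 <= cosh x.
Proof. by rewrite /cosh; have := expR_opp_add_ge2 x; lra. Qed.

Lemma cosh_ge_half_expR (R : realType) (x : R) : expR x / 2 <= cosh x.
Proof. by rewrite /cosh; have := expR_ge0 (- x); lra. Qed.

Lemma coshD_avg (R : realType) (x y : R) :
  cosh (x + y) + cosh (x - y) = 2 * cosh x * cosh y.
Proof. by rewrite /cosh !opprD opprK !expRD; field. Qed.

(** The bound 1/(1 - x^2/2) is rational with the right second-order term, so that the one-step
    growth of [cosh] becomes the algebraic condition [kapE]. The difference vanishes at 0 and has
    derivative 2(x cosh x - sinh x) + x^2 sinh x, both parts being nonnegative for x >= 0. *)
Lemma cosh_mul_le1 (R : realType) (x : R) : cosh x * (1 - x ^+ 2 / 2) <= 1.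
Proof.
wlog x0 : x / 0 <= x.
  move=> H; case: (lerP 0 x) => [/H//|x0]; rewrite -coshN -sqrrN; apply: H; lra.
have : 0 <= 2 - (expR x + expR (- x)) * (1 - x ^+ 2 / 2); last by rewrite /cosh; lra.
apply: (@derive_ge0_ge0 _ (fun x => 2 - (expR x + expR (- x)) * (1 - x ^+ 2 / 2))
  (fun x => x * (expR x + expR (- x)) - (expR x - expR (- x)) +
    x ^+ 2 / 2 * (expR x - expR (- x)))) => //.
- by move=> y; apply: is_derive_eq; rewrite /GRing.scale /=; field.
- move=> y y0; have := sinh_le_mul_cosh y0; have := sinh_ge_id y0 => h1 h2.
  have : 0 <= y ^+ 2 / 2 * (expR y - expR (- y)).
    by apply: mulr_ge0; [have := sqr_ge0 y|]; lra.
  lra.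
- by rewrite oppr0 expR0; ring.
Qed.

Lemma cosh_homo (R : realType) (x y : R) : 0 <= x -> x <= y -> cosh x <= cosh y.
Proof.
move=> x0 xy.
have h1 : 0 < expR x by exact: expR_gt0.
have h2 : expR x <= expR y by rewrite ler_expR.
have h3 : 1 <= expR x by rewrite -expR0 ler_expR.
rewrite /cosh !expRN ler_pM2r ?invr_gt0 //.
have : 0 <= (expR y - expR x) * (1 - (expR x * expR y)^-1).
  apply: mulr_ge0; rewrite ?subr_ge0 //.
  by rewrite invf_le1; nra.
suff -> : (expR y - expR x) * (1 - (expR x * expR y)^-1) =
  expR y + (expR y)^-1 - (expR x + (expR x)^-1) by rewrite subr_ge0.
by field; rewrite !gt_eqF ?expR_gt0.
Qed.

Lemma ln_le_half_sub_inv (R : realType) (t : R) : 1 <= t -> ln t <= (t - t^-1) / 2.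
Proof.
move=> t1; have := sinh_ge_id (ln_ge0 t1).
by rewrite expRN lnK ?posrE; lra.
Qed.

(** The left side is ln(1 - a^2) + a ln((1 + a)/(1 - a)), and [ln_le_half_sub_inv] bounds the second
    logarithm by 2a/(1 - a^2). The coefficient of a^2 is exactly 1, which keeps the final constant
    sharp. *)
Lemma entropy_pair_le (R : realType) (a : R) : `|a| < 1 ->
  (1 + a) * ln (1 + a) + (1 - a) * ln (1 - a) <= a ^+ 2 * (1 + a ^+ 2) / (1 - a ^+ 2).
Proof.
wlog a0 : a / 0 <= a.
  move=> H; case: (lerP 0 a) => [/H//|a0] a1.
  have := H (- a); rewrite normrN sqrrN opprK => /(_ _ a1); lra.
rewrite ger0_norm // => a1.
have h : 0 < 1 - a ^+ 2 by nra.
have -> : (1 + a) * ln (1 + a) + (1 - a) * ln (1 - a) =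
    ln (1 - a ^+ 2) + a * ln ((1 + a) / (1 - a)).
  have -> : 1 - a ^+ 2 = (1 + a) * (1 - a) by ring.
  by rewrite lnM ?ln_div ?posrE; [ring|lra..].
have h1 : ln (1 - a ^+ 2) <= - a ^+ 2.
  by rewrite -[leRHS]expRK ler_ln ?posrE ?expR_gt0 // expR_ge1Dx.
have : a * ln ((1 + a) / (1 - a)) <= a * ((((1 + a) / (1 - a)) - ((1 + a) / (1 - a))^-1) / 2).
  apply: ler_wpM2l => //; apply: ln_le_half_sub_inv.
  by rewrite ler_pdivlMr; lra.
have -> : a ^+ 2 * (1 + a ^+ 2) / (1 - a ^+ 2) = - a ^+ 2 +
   a * ((((1 + a) / (1 - a)) - ((1 + a) / (1 - a))^-1) / 2).
  by field; rewrite !gt_eqF //; lra.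
lra.
Qed.

(** * The walk and its survival weights *)

Lemma independent_seq (dO : measure_display)
    (Omega : measurableType dO) (R : realType) (P : probability Omega R)
    (I : choiceType) (E : Type) (G : set (set E)) (X : I -> Omega -> E)
    (s : seq I) (B : I -> set E) :
  mutually_independent P G X -> uniq s -> (forall i, i \in s -> G (B i)) ->
  P (\bigcap_(i in [set` s]) (X i @^-1` B i)) =
    (\prod_(i <- s) P (X i @^-1` B i))%E.
Proof.
move=> indep us GB.
have pm : perm_eq (seq_fset tt s) s.
  by have := seq_fset_perm tt s; rewrite (undup_id us).
have := indep (seq_fset tt s) B; rewrite (perm_big s pm) /= => <-.
  by congr (P _); apply/seteqP; split=> w h i /=; [rewrite (perm_mem pm)|rewrite -(perm_mem pm)]; exact: h.
by move=> i; rewrite (perm_mem pm); exact: GB.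
Qed.

Definition step (d : nat) (s : 'I_d * bool) : 'rV[int]_d :=
  if s.2 then - delta_mx 0 s.1 else delta_mx 0 s.1.

Lemma stepE (d : nat) (s : 'I_d * bool) (j : 'I_d) :
  step s 0 j = if s.1 == j then (if s.2 then -1 else 1) else 0.
Proof.
by rewrite /step; case: s => i [] /=; rewrite !mxE eqxx /= eq_sym; case: eqP.
Qed.

Lemma step_inj (d : nat) : injective (@step d).
Proof.
move=> [i a] [j b] /rowP /(_ i); rewrite !stepE /= eqxx.
by case: eqP => [->|_]; case: a; case: b.
Qed.

Lemma step_neighbor (d : nat) (s : 'I_d * bool) : neighbor_of_origin (step s).
Proof.
rewrite /neighbor_of_origin (bigD1 s.1) //= big1 ?stepE ?eqxx => [|i].
  by case: s => i [].
by rewrite stepE eq_sym => /negPf ->.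
Qed.

(* [walk_survival u y n x] is the survival weight of the walk started at [x]
   and restricted to the paths that hit [y] within [n] steps. *)
Fixpoint walk_survival (R : realType) (d : nat) (u : 'rV[int]_d -> R)
    (y : 'rV[int]_d) (n : nat) (x : 'rV[int]_d) : R :=
  if x == y then 1 else
  if n is n'.+1 then
    expR (- u x) * ((2 * d)%N%:R^-1 * \sum_s walk_survival u y n' (x + step s))
  else 0.

(** The recursion of [walk_survival] along a single path; it increases with [n] to the integrand of
    [survival]. *)
Fixpoint path_survival (R : realType) (d : nat) (u : 'rV[int]_d -> R)
    (y : 'rV[int]_d) (n : nat) (s : nat -> 'rV[int]_d) : R :=
  if s 0%N == y then 1 else
  if n is n'.+1 then expR (- u (s 0%N)) * path_survival u y n' (fun k => s k.+1)
  else 0.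

Section path_survival.
Variables (R : realType) (d : nat) (u : 'rV[int]_d -> R) (y : 'rV[int]_d).

Lemma path_survival_ge0 n s : 0 <= path_survival u y n s.
Proof.
elim: n s => [|n IH] s /=; case: ifP => // _.
by rewrite mulr_ge0 ?expR_ge0.
Qed.

Lemma path_survival_leS n s : path_survival u y n s <= path_survival u y n.+1 s.
Proof.
elim: n s => [|n IH] s.
  by rewrite /=; case: ifP => // _; rewrite mulr_ge0 ?expR_ge0 //; case: ifP.
rewrite [leLHS]/= [leRHS]/=; case: ifP => // _.
by apply: ler_wpM2l; [exact: expR_ge0|exact: IH].
Qed.

Lemma path_survival_before n s : (forall k, (k <= n)%N -> s k != y) ->
  path_survival u y n s = 0.
Proof.
elim: n s => [|n IH] s ne /=; rewrite (negPf (ne 0%N isT)) //.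
by rewrite IH ?mulr0 // => k kn; exact: ne.
Qed.

Lemma path_survival_after n h s : s h == y ->
  (forall k, (k < h)%N -> s k != y) -> (h <= n)%N ->
  path_survival u y n s = expR (- \sum_(k < h) u (s k)).
Proof.
elim: h n s => [|h IH] n s shy ne hn.
  by rewrite big_ord0 oppr0 expR0; case: n hn => [|n] _ /=; rewrite shy.
case: n hn => // n hn /=; rewrite (negPf (ne 0%N isT)) (IH n) //; last first.
  by move=> k kh; exact: ne.
by rewrite big_ord_recl opprD expRD.
Qed.

Lemma path_survival_cvg s :
  path_survival u y n s @[n --> \oo] -->
    (if hitting_time s y is Some h then expR (- \sum_(k < h) u (s k)) else 0).
Proof.
rewrite /hitting_time; case: pselect => [ex|nex].
  case: ex_minnP => h shy hmin.
  apply: cvg_near_cst; exists h => // n /= hn.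
  apply: path_survival_after => // k kh; apply/negP => /hmin.
  by rewrite leqNgt kh.
apply: cvg_near_cst; near=> n; apply: path_survival_before => k _.
by apply/negP => sky; apply: nex; exists k.
Unshelve. all: by end_near. Qed.

Lemma walk_survival_ge0 n x : 0 <= walk_survival u y n x.
Proof.
elim: n x => [|n IH] x /=; case: ifP => // _.
by rewrite !mulr_ge0 ?expR_ge0 ?sumr_ge0.
Qed.

Lemma walk_survival_leS n x : walk_survival u y n x <= walk_survival u y n.+1 x.
Proof.
elim: n x => [|n IH] x.
  rewrite /=; case: ifP => // _; rewrite !mulr_ge0 ?expR_ge0 // sumr_ge0 // => s _.
  by case: ifP.
rewrite [leLHS]/= [leRHS]/=; case: ifP => // _.
by apply: ler_wpM2l; [exact: expR_ge0|]; apply: ler_wpM2l => //; exact: ler_sum.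
Qed.

Lemma walk_survival_le n m x : (n <= m)%N ->
  walk_survival u y n x <= walk_survival u y m x.
Proof.
have /nondecreasing_seqP h k : walk_survival u y k x <= walk_survival u y k.+1 x.
  exact: walk_survival_leS.
exact: h.
Qed.

End path_survival.

(** * Markov property of the walk, on cylinder events *)

Section markov.
Variables (dW : measure_display) (W : measurableType dW) (R : realType).
Variables (Q : probability W R) (d : nat) (S : nat -> W -> 'rV[int]_d).
Hypothesis d_gt0 : (0 < d)%N.
Hypothesis hS : simple_random_walk Q S.
Variables (u : 'rV[int]_d -> R) (y : 'rV[int]_d).
Hypothesis u_ge0 : forall x, 0 <= u x.

Let p : R := (2 * d)%N%:R^-1.

Let S_measurable n z : measurable [set w | S n w = z].
Proof. by case: hS. Qed.

Lemma measurable_fun_discrete (X : W -> 'rV[int]_d) (f : 'rV[int]_d -> R) :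
  (forall z, measurable [set w | X w = z]) -> measurable_fun setT (f \o X).
Proof.
move=> mX _ B mB; rewrite setTI.
have -> : (f \o X) @^-1` B =
    \bigcup_z [set w | X w = z /\ B (f z)].
  by apply/seteqP; split => w /= => [Bw|[z _ [<-]]//]; exists (X w).
apply: countable_bigcupT_measurable => [|z]; first exact: countableP.
have [Bz|nBz] := pselect (B (f z)).
  rewrite (_ : [set _ | _] = [set w | X w = z]) //.
  by apply/seteqP; split => w /= => [[]|].
rewrite (_ : [set _ | _] = set0) //.
by apply/seteqP; split => w /= => [[]|].
Qed.

Lemma measurable_path_survival n j :
  measurable_fun setT (fun w => path_survival u y n (fun k => S (j + k) w)).
Proof.
elim: n j => [|n IH] j /=.
  by apply: (@measurable_fun_discrete (S (j + 0)) (fun z => if z == y then 1 else 0)).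
rewrite (_ : (fun w => _) = (fun w => (if S (j + 0) w == y then 1 else 0) +
   (if S (j + 0) w == y then 0 else expR (- u (S (j + 0) w))) *
   path_survival u y n (fun k => S (j.+1 + k) w))).
  apply: measurable_funD.
    by apply: (@measurable_fun_discrete (S (j + 0)) (fun z => if z == y then 1 else 0)).
  apply: measurable_funM => //.
  by apply: (@measurable_fun_discrete (S (j + 0))
     (fun z => if z == y then 0 else expR (- u z))).
apply/funext => w; case: eqP => _; first by rewrite mul0r addr0.
rewrite add0r; congr (_ * path_survival _ _ _ _).
by apply/funext => k; rewrite addSnnS.
Qed.

Let cylinder (t : seq ('I_d * bool)) : set W :=
  [set w | forall i, (i < size t)%N ->
     S i.+1 w - S i w = step (nth (Ordinal d_gt0, false) t i)].

Let incr_measurable n z : measurable [set w | S n.+1 w - S n w = z].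
Proof.
rewrite (_ : [set _ | _] = \bigcup_x ([set w | S n w = x] `&` [set w | S n.+1 w = z + x])).
  apply: countable_bigcupT_measurable => [|x]; first exact: countableP.
  exact: measurableI.
apply/seteqP; split => w /= => [<-|[x _ [-> ->]]]; last by rewrite addrK.
by exists (S n w) => //; split => //; rewrite subrK.
Qed.

Let cylinderE t : cylinder t = \bigcap_(i in [set` iota 0 (size t)])
  ((fun w => S i.+1 w - S i w) @^-1` [set step (nth (Ordinal d_gt0, false) t i)]).
Proof.
apply/seteqP; split => w /= h i; first by rewrite /= mem_iota => it; exact: h.
by move=> it; apply: h; rewrite /= mem_iota.
Qed.

Let cylinder_measurable t : measurable (cylinder t).
Proof.
by rewrite cylinderE; apply: bigcap_measurableType => i _; exact: incr_measurable.
Qed.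

Let cylinder_prob t : Q (cylinder t) = (p ^+ size t)%:E.
Proof.
case: hS => _ _ indep law; rewrite cylinderE (independent_seq indep) ?iota_uniq //.
transitivity (\prod_(i <- iota 0 (size t)) p%:E)%E.
  apply: eq_bigr => i _.
  by have := law i (step (nth (Ordinal d_gt0, false) t i)); rewrite step_neighbor.
by rewrite prodEFin big_const_seq count_predT size_iota -Monoid.iteropE.
Qed.

Let cylinder_rcons t s : cylinder (rcons t s) =
  cylinder t `&` [set w | S (size t).+1 w - S (size t) w = step s].
Proof.
apply/seteqP; split => w /=.
  move=> h; split=> [i it|]; last by rewrite h ?size_rcons // nth_rcons ltnn eqxx.
  by rewrite h ?size_rcons ?ltnS 1?ltnW // nth_rcons it.
move=> [h hs] i; rewrite size_rcons ltnS leq_eqVlt nth_rcons => /orP[/eqP ->|it].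
  by rewrite ltnn eqxx.
by rewrite it; exact: h.
Qed.

(** Increments are unit steps only almost surely, so the longer cylinders need not cover
    [cylinder t] pointwise. They are disjoint and their masses add up, 2d p^(n+1) = p^n, hence what
    is left over is negligible. *)
Lemma integral_cylinder_split t (f : W -> R) : measurable_fun setT f ->
  (forall w, 0 <= f w) ->
  (\int[Q]_(w in cylinder t) (f w)%:E =
   \sum_(s : 'I_d * bool) \int[Q]_(w in cylinder (rcons t s)) (f w)%:E)%E.
Proof.
move=> mf f0.
pose D := \big[setU/set0]_(s <- enum {: 'I_d * bool}) cylinder (rcons t s).
have mD : measurable D by apply: bigsetU_measurable.
have DT : D `<=` cylinder t.
  by rewrite /D -bigcup_seq => w [s _]; rewrite cylinder_rcons => -[].
have tD : trivIset [set` enum {: 'I_d * bool}] (fun s => cylinder (rcons t s)).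
  apply/trivIsetP => s s' _ _ ss'; rewrite !cylinder_rcons.
  apply/seteqP; split => w //= [[_ h1] [_ h2]].
  by move/eqP: ss'; apply; apply: (@step_inj d); rewrite -h1 -h2.
have QD : Q D = Q (cylinder t).
  rewrite -[LHS]mul1e -integral_cst // /D.
  rewrite (@ge0_integral_bigsetU _ _ _ Q _ (fun s => cylinder (rcons t s))) ?enum_uniq //.
  transitivity (\sum_(s <- enum {: 'I_d * bool}) (p ^+ (size t).+1)%:E)%E.
    apply: eq_bigr => s _.
    rewrite integral_cst // mul1e.
    by have := cylinder_prob (rcons t s); rewrite size_rcons.
  rewrite cylinder_prob sumEFin big_enum /= sumr_const card_prod card_ord card_bool.
  congr (_%:E); rewrite exprS -mulrnAl -mulr_natl /p mulnC mulfV ?mul1r //.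
  by rewrite pnatr_eq0 muln_eq0 /= -lt0n.
have mC := cylinder_measurable t.
have mN : measurable (cylinder t `\` D) by exact: measurableD.
have mfA A : measurable_fun A (fun w => (f w)%:E).
  by apply/measurable_EFinP; exact: measurable_funTS.
rewrite (@ge0_negligible_integral _ _ _ Q (cylinder t) (cylinder t `\` D)) //; last 2 first.
- by move=> w _; rewrite lee_fin.
- rewrite measureD //; last by rewrite (le_lt_trans (probability_le1 _ _)) ?ltry.
  rewrite setIidr //; transitivity (Q (cylinder t) - Q (cylinder t))%E.
    by congr (_ - _)%E.
  by rewrite subee // fin_num_measure.
rewrite setDD setIidr //.
rewrite (@ge0_integral_bigsetU _ _ _ Q _ (fun s => cylinder (rcons t s))) ?enum_uniq //.
  by rewrite big_enum.
by move=> w _; rewrite lee_fin.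
Qed.

Let pos (t : seq ('I_d * bool)) : 'rV[int]_d := \sum_(s <- t) step s.

Let cylinder_pos t w : cylinder t w -> S (size t) w = pos t.
Proof.
elim/last_ind: t => [|t s IH] h; first by rewrite /pos big_nil; case: hS => _ ->.
rewrite cylinder_rcons in h; case: h => h1 /= h2.
by rewrite size_rcons /pos -cats1 big_cat big_seq1 /= -/(pos t) -IH // -h2 addrC subrK.
Qed.

Let integral_cylinder_cst t r :
  (\int[Q]_(w in cylinder t) r%:E = (p ^+ size t * r)%:E)%E.
Proof.
transitivity (r%:E * Q (cylinder t))%E; first exact: integral_cst.
by rewrite cylinder_prob -EFinM mulrC.
Qed.

(** Induction on [n] for all [t] at once: on a cylinder the current position is frozen at [pos t],
    and taking one step splits the cylinder. *)
Lemma integral_cylinder_path_survival n t :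
  (\int[Q]_(w in cylinder t)
     (path_survival u y n (fun k => S (size t + k) w))%:E =
   (p ^+ size t * walk_survival u y n (pos t))%:E)%E.
Proof.
elim: n t => [|n IH] t.
  under eq_integral.
    move=> w; rewrite inE => /cylinder_pos h.
    rewrite /= addn0 h (_ : (if _ then _ else _) = walk_survival u y 0 (pos t)) //.
    over.
  by rewrite integral_cylinder_cst.
have [ty|ty] := boolP (pos t == y).
  under eq_integral.
    move=> w; rewrite inE => /cylinder_pos h.
    rewrite /= addn0 h ty.
    over.
  by rewrite integral_cylinder_cst /= ty.
under eq_integral.
  move=> w; rewrite inE => /cylinder_pos h.
  rewrite /= addn0 h (negPf ty) EFinM.
  rewrite (_ : (fun k => S (size t + k.+1) w) = (fun k => S ((size t).+1 + k) w)); last first.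
    by apply/funext => k; rewrite addSnnS.
  over.
rewrite ge0_integralZl_EFin ?expR_ge0 //; last 2 first.
- by move=> w _; rewrite lee_fin path_survival_ge0.
- by apply/measurable_EFinP; apply: measurable_funTS; exact: measurable_path_survival.
rewrite integral_cylinder_split; last 2 first.
- exact: measurable_path_survival.
- by move=> w; exact: path_survival_ge0.
under eq_bigr => s _ do rewrite -(size_rcons t s) IH size_rcons.
rewrite sumEFin -EFinM /= (negPf ty); congr (_%:E).
rewrite -mulr_sumr exprS -/p.
have -> : \sum_s walk_survival u y n (pos (rcons t s)) =
    \sum_s walk_survival u y n (pos t + step s).
  by apply: eq_bigr => s _; rewrite /pos -cats1 big_cat big_seq1.
by ring.
Qed.

(** Monotone convergence in the number of allowed steps. From here on the estimates deal with the
    recursion [walk_survival] instead of the probability space of the walk. *)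
Lemma walk_survival_cvg :
  walk_survival u y n 0 @[n --> \oo] --> survival Q S u y.
Proof.
pose I w := if hitting_time (S ^~ w) y is Some h then expR (- \sum_(n < h) u (S n w)) else 0.
have cI w : path_survival u y n (S ^~ w) @[n --> \oo] --> I w.
  exact: path_survival_cvg.
have mpath n : measurable_fun setT (fun w => path_survival u y n (S ^~ w)).
  exact: (measurable_path_survival n 0).
have intE n : (\int[Q]_w (path_survival u y n (S ^~ w))%:E = (walk_survival u y n 0)%:E)%E.
  have := integral_cylinder_path_survival n [::].
  rewrite /pos big_nil expr0 mul1r (_ : cylinder [::] = setT) //.
  by apply/seteqP; split.
have : (\int[Q]_w (path_survival u y n (S ^~ w))%:E)%E @[n --> \oo] --> (\int[Q]_w (I w)%:E)%E.
  have -> : (\int[Q]_w (I w)%:E = \int[Q]_w limn (fun n => (path_survival u y n (S ^~ w))%:E))%E.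
    apply: eq_integral => w _; apply/esym/cvg_lim => //.
    by apply: cvg_EFin; [exact: nearW|exact: cI].
  apply: cvg_monotone_convergence => //.
  - by move=> n; apply/measurable_EFinP.
  - by move=> n w _; rewrite lee_fin path_survival_ge0.
  - move=> w _ m n mn; rewrite lee_fin.
    have /nondecreasing_seqP h k : path_survival u y k (S ^~ w) <= path_survival u y k.+1 (S ^~ w).
      exact: path_survival_leS.
    exact: h.
under eq_fun do rewrite intE.
have Ile1 w : 0 <= I w <= 1.
  rewrite /I; case: hitting_time => [h|]; rewrite ?lexx ?ler01 //.
  by rewrite expR_ge0 expR_le1 oppr_le0 sumr_ge0.
have mI : measurable_fun setT I.
  by apply: (measurable_fun_cvg mpath) => w _; exact: cI.
have : (\int[Q]_w (I w)%:E \is a fin_num)%E.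
  rewrite ge0_fin_numE; last by apply: integral_ge0 => w _; rewrite lee_fin; case/andP: (Ile1 w).
  apply: (@le_lt_trans _ _ (\int[Q]_w (cst 1%:E) w)%E).
    apply: ge0_le_integral => //.
    - by move=> w _; rewrite lee_fin; case/andP: (Ile1 w).
    - exact/measurable_EFinP.
    - by move=> w _; rewrite lee_fin; case/andP: (Ile1 w).
  by rewrite integral_cst //= probability_setT mul1e ltry.
rewrite /survival unlock -/I; set J := (\int[Q]_w _)%E => /fineK {1}<-.
by move=> /fine_cvg.
Qed.

End markov.

(** * Cost of tilted paths *)

Definition norm1 (d : nat) (x : 'rV[int]_d) : nat := (\sum_(i < d) `|x 0%R i|)%N.

(** The default [s0] is returned only at [x = y], where no step comes closer; it also witnesses that
    d > 0. *)
Definition step_toward (d : nat) (y x : 'rV[int]_d) (s0 : 'I_d * bool) : 'I_d * bool :=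
  odflt s0 [pick s | (norm1 (x + step s - y) < norm1 (x - y))%N].

Lemma norm1_add_step (d : nat) (x : 'rV[int]_d) s : (norm1 (x + step s) <= (norm1 x).+1)%N.
Proof.
apply: (@leq_trans (\sum_(i < d) (`|x 0%R i| + `|step s 0%R i|))%N).
  by apply: leq_sum => i _; rewrite mxE -lez_nat PoszD !abszE ler_normD.
by rewrite big_split /= (eqP (step_neighbor s)) addn1.
Qed.

Lemma norm1_eq0 (d : nat) (x : 'rV[int]_d) : (norm1 x == 0)%N = (x == 0).
Proof.
rewrite sum_nat_eq0; apply/forallP/eqP => [h|-> i]; last by rewrite mxE.
by apply/rowP => i; have := h i; rewrite mxE /= absz_eq0 => /eqP.
Qed.

Lemma absz_toward (a b : int) : a - b != 0 ->
  (`|(a + (if 0 < a - b then -1 else 1) - b)%R| < `|(a - b)%R|)%N.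
Proof. by case: ltrP; lia. Qed.

Lemma step_towardP (d : nat) (y x : 'rV[int]_d) s0 : x != y ->
  (norm1 (x + step (step_toward y x s0) - y) < norm1 (x - y))%N.
Proof.
move=> xy; rewrite /step_toward; case: pickP => //= none.
have : norm1 (x - y) != 0%N by rewrite norm1_eq0 subr_eq0.
rewrite /norm1 sum_nat_eq0 negb_forall => /existsP[i] /=.
rewrite !mxE absz_eq0 => xyi.
have := none (i, 0 < x 0 i - y 0 i) => /negP[].
rewrite /norm1 (bigD1 i) //= [ltnRHS](bigD1 i) //=.
rewrite !mxE stepE /= eqxx.
rewrite (eq_bigr (fun j => `|(x - y)%R 0%R j|%N)); last first.
  by move=> j ji; rewrite !mxE stepE /= eq_sym (negPf ji) addr0.
by rewrite ltn_add2r; exact: absz_toward.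
Qed.

Section path_cost.
Variables (R : realType) (d : nat) (s0 : 'I_d * bool) (y : 'rV[int]_d).

(** Minus the logarithm of the weight of one greedy path: forcing a step of probability 1/(2d) costs
    [ln (2 * d)]. *)
Fixpoint straight_cost (u : 'rV[int]_d -> R) (k : nat) (x : 'rV[int]_d) : R :=
  if k is k'.+1 then
    if x == y then 0 else
    u x + ln (2 * d)%N%:R + straight_cost u k' (x + step (step_toward y x s0))
  else 0.

Variables (q : 'I_d * bool -> R) (c : R).

(* The mean cost of [n] steps with law [q] followed by a straight path to [y];
   [c] stands for (a bound on) the relative entropy of [q]. *)
Fixpoint tilted_cost (u : 'rV[int]_d -> R) (n : nat) (x : 'rV[int]_d) : R :=
  if n is n'.+1 then u x + c + \sum_s q s * tilted_cost u n' (x + step s)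
  else straight_cost u (norm1 (x - y)) x.

Let d_gt0 : (0 < d)%N. Proof. by case: s0 => -[]; case: (d). Qed.

Let logd_ge0 : 0 <= ln (2 * d)%N%:R :> R.
Proof. by apply: ln_ge0; rewrite ler1n; lia. Qed.

Hypothesis q_gt0 : forall s, 0 < q s.
Hypothesis q_sum1 : \sum_s q s = 1.
Hypothesis c_ge0 : 0 <= c.
Hypothesis entropy_le : \sum_s q s * ln ((2 * d)%N%:R * q s) <= c.

Lemma straight_cost_ge0 u k x : (forall x, 0 <= u x) -> 0 <= straight_cost u k x.
Proof.
move=> u0; elim: k x => [|k IH] x //=; case: ifP => // _.
by rewrite !addr_ge0.
Qed.

Lemma tilted_cost_ge0 u n x : (forall x, 0 <= u x) -> 0 <= tilted_cost u n x.
Proof.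
move=> u0; elim: n x => [|n IH] x /=; first exact: straight_cost_ge0.
by rewrite !addr_ge0 // sumr_ge0 // => s _; rewrite mulr_ge0 // ltW.
Qed.

Lemma walk_survival_ge_straight u k x : (forall x, 0 <= u x) ->
  (norm1 (x - y) <= k)%N -> expR (- straight_cost u k x) <= walk_survival u y k x.
Proof.
move=> u0; elim: k x => [|k IH] x xk.
  move: xk; rewrite leqn0 norm1_eq0 subr_eq0 => /= ->.
  by rewrite oppr0 expR0.
rewrite /=; case: ifPn => [_|xy]; first by rewrite oppr0 expR0.
rewrite !opprD !expRD -mulrA ler_pM2l ?expR_gt0 // expRN lnK; last first.
  by rewrite posrE ltr0n muln_gt0.
rewrite ler_pM2l ?invr_gt0 ?ltr0n ?muln_gt0 //.
rewrite (bigD1 (step_toward y x s0)) //= ler_wpDr ?sumr_ge0 //.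
  by move=> s _; exact: walk_survival_ge0.
by apply: IH; rewrite -ltnS; exact: leq_trans (step_towardP s0 xy) xk.
Qed.

(** Gibbs variational inequality relative to the uniform step law: after the change of measure to
    [q], the exponential is bounded below by its tangent at the [q]-mean [m]. *)
Lemma jensen_expR (a : 'I_d * bool -> R) :
  expR (- (c + \sum_s q s * a s)) <= (2 * d)%N%:R^-1 * \sum_s expR (- a s).
Proof.
have D0 : 0 < (2 * d)%N%:R :> R by rewrite ltr0n muln_gt0.
pose b s := - a s - ln ((2 * d)%N%:R * q s).
pose m := \sum_s q s * b s.
apply: (@le_trans _ _ (expR m)).
  have -> : m = - \sum_s q s * a s - \sum_s q s * ln ((2 * d)%N%:R * q s).
    by rewrite /m -sumrN -sumrB; apply: eq_bigr => s _; rewrite /b; ring.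
  by rewrite ler_expR opprD addrC lerD2l lerN2.
rewrite mulr_sumr.
have -> : \sum_s (2 * d)%N%:R^-1 * expR (- a s) = \sum_s q s * expR (b s).
  apply: eq_bigr => s _; rewrite /b expRB lnK ?posrE ?mulr_gt0 //.
  by field; rewrite gt_eqF //= pnatr_eq0 -lt0n.
have -> : expR m = \sum_s q s * (expR m * (1 + (b s - m))).
  under eq_bigr do rewrite mulrCA mulrDr mulr1.
  rewrite -mulr_sumr big_split /= q_sum1 (eq_bigr (fun s => q s * b s - q s * m)).
    by rewrite sumrB -mulr_suml q_sum1 -/m; ring.
  by move=> s _; ring.
apply: ler_sum => s _; rewrite ler_pM2l //.
have -> : expR (b s) = expR m * expR (b s - m) by rewrite -expRD addrC subrK.
by rewrite ler_pM2l ?expR_gt0 // expR_ge1Dx.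
Qed.

(** Each of the [n] tilted steps may increase the distance to [y] by one, and the straight path must
    then undo it: hence the horizon with [2 * n]. *)
Lemma walk_survival_ge_tilted u n m x : (forall x, 0 <= u x) ->
  (norm1 (x - y)%R + 2 * n <= m)%N ->
  expR (- tilted_cost u n x) <= walk_survival u y m x.
Proof.
move=> u0; elim: n m x => [|n IH] m x nm.
  apply: (le_trans (walk_survival_ge_straight u0 (leqnn _))).
  by apply: walk_survival_le => //; lia.
case: m nm => [|m] nm; first by lia.
rewrite [walk_survival _ _ _ _]/=; case: ifP => _.
  by rewrite expR_le1 oppr_le0; exact: tilted_cost_ge0.
rewrite [tilted_cost _ _ _]/= -addrA opprD expRD ler_pM2l ?expR_gt0 //.
apply: (le_trans (jensen_expR _)).
rewrite ler_pM2l ?invr_gt0 ?ltr0n ?muln_gt0 //.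
apply: ler_sum => s _; apply: IH.
rewrite addrAC; apply: leq_trans (leq_add (norm1_add_step _ _) (leqnn _)) _.
by move: (norm1 _) nm => k; lia.
Qed.

Definition drift (i : 'I_d) : R := q (i, false) - q (i, true).

(** Squared distance from [y] to the mean position after [n] more tilted steps. *)
Definition sqdist (n : nat) (x : 'rV[int]_d) : R :=
  \sum_i ((x 0 i - y 0 i)%:~R + n%:R * drift i) ^+ 2.

Lemma sum_dir (F : 'I_d * bool -> R) :
  \sum_s F s = \sum_i (F (i, true) + F (i, false)).
Proof.
rewrite (eq_bigr (fun s => F (s.1, s.2))); last by case.
rewrite -(pair_big xpredT xpredT (fun i b => F (i, b))) /=.
by apply: eq_bigr => i _; rewrite big_bool.
Qed.

Lemma sqdist_step n x s : sqdist n (x + step s) = sqdist n x +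
  2 * (if s.2 then -1 else 1) * ((x 0 s.1 - y 0 s.1)%:~R + n%:R * drift s.1) + 1.
Proof.
rewrite /sqdist (bigD1 s.1) //= [in RHS](bigD1 s.1) //=.
rewrite (eq_bigr (fun i => ((x 0 i - y 0 i)%:~R + n%:R * drift i) ^+ 2)); last first.
  by move=> i is1; rewrite mxE stepE eq_sym (negPf is1) addr0.
rewrite mxE stepE eqxx !rmorphB rmorphD /=.
by case: s => i [] /=; ring.
Qed.

(** The position plus the remaining drift is a martingale, so one step adds only its variance, which
    is 1 - |drift|^2. *)
Lemma sqdist_mean n x : \sum_s q s * sqdist n (x + step s) <= sqdist n.+1 x + 1.
Proof.
pose e s := q s * (2 * (if s.2 then -1 else 1) * ((x 0 s.1 - y 0 s.1)%:~R + n%:R * drift s.1)).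
rewrite (eq_bigr (fun s => q s * (sqdist n x + 1) + e s)); last first.
  by move=> s _; rewrite sqdist_step /e; ring.
rewrite big_split /= -mulr_suml q_sum1 mul1r addrAC lerD2r.
have -> : sqdist n.+1 x = sqdist n x +
    \sum_i 2 * drift i * ((x 0 i - y 0 i)%:~R + n%:R * drift i) + \sum_i drift i ^+ 2.
  rewrite /sqdist -!big_split /=; apply: eq_bigr => i _.
  by rewrite -natr1; ring.
rewrite sum_dir ler_wpDr ?sumr_ge0 //; first by move=> i _; exact: sqr_ge0.
rewrite lerD2l le_eqVlt; apply/orP; left; apply/eqP.
by apply: eq_bigr => i _; rewrite /e /= /drift; ring.
Qed.

Lemma straight_cost_const mu k x : 0 <= mu ->
  straight_cost (fun=> mu) k x <= (mu + ln (2 * d)%N%:R) * k%:R.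
Proof.
move=> mu0; elim: k x => [|k IH] x /=; first by rewrite mulr0.
case: ifP => _; first by rewrite mulr_ge0 // addr_ge0.
by rewrite -natr1 mulrDr mulr1 addrC lerD2r.
Qed.

(** The final straight path costs at most C times an l1 distance. Each coordinate satisfies |t| <=
    eta t^2 + 1/eta, and [sqdist_mean] makes the squares grow by at most 1 per step; this gives an
    error of C eta per step plus a constant. *)
Lemma tilted_cost_const mu eta n x : 0 <= mu -> 0 < eta ->
  let C := mu + ln (2 * d)%N%:R in
  tilted_cost (fun=> mu) n x <= n%:R * (mu + c + C * eta) +
    C * eta * sqdist n x + C * d%:R / eta.
Proof.
move=> mu0 eta0 /=; set C := _ + ln _.
have C0 : 0 <= C by rewrite addr_ge0.
elim: n x => [|n IH] x /=.
  apply: (le_trans (straight_cost_const _ _ mu0)); rewrite -/C mul0r add0r -mulrA.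
  rewrite -[C * d%:R / eta]mulrA -mulrDr; apply: ler_wpM2l => //.
  have -> : d%:R / eta = \sum_(i < d) eta^-1.
    by rewrite sumr_const card_ord mulrC mulr_natr.
  rewrite /sqdist mulr_sumr -big_split /= natr_sum; apply: ler_sum => i _.
  rewrite !mxE mul0r addr0; set z : int := _ - _.
  have -> : (`|z|%N%:R : R) = `|z%:~R : R| by rewrite -intr_norm natr_absz.
  rewrite -(real_normK (num_real _)); move: (normr_ge0 (z%:~R : R)).
  set t := `|_ |; move=> t0.
  have -> : eta * t ^+ 2 + eta^-1 = ((eta * t) ^+ 2 + 1) / eta by field; rewrite gt_eqF.
  rewrite ler_pdivlMr //; nra.
apply: (@le_trans _ _ (mu + c + \sum_s q s * (n%:R * (mu + c + C * eta) +
    C * eta * sqdist n (x + step s) + C * d%:R / eta))).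
  by rewrite lerD2l; apply: ler_sum => s _; rewrite ler_pM2l.
rewrite (eq_bigr (fun s => q s * (n%:R * (mu + c + C * eta) + C * d%:R / eta) +
   C * eta * (q s * sqdist n (x + step s)))); last by move=> s _; ring.
rewrite big_split /= -mulr_suml -mulr_sumr q_sum1 mul1r -natr1.
have : C * eta * (\sum_s q s * sqdist n (x + step s)) <= C * eta * (sqdist n.+1 x + 1).
  by apply: ler_wpM2l; [rewrite mulr_ge0 // ltW|exact: sqdist_mean].
by lra.
Qed.

End path_cost.

(** * Jensen bounds on the exponents *)

Section ge0_expectation.
Variables (dO : measure_display) (Omega : measurableType dO) (R : realType).
Variable (P : probability Omega R).
Implicit Types f g : Omega -> R.

Lemma ge0_expectationD f g : measurable_fun setT f -> measurable_fun setT g ->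
  (forall w, 0 <= f w) -> (forall w, 0 <= g w) ->
  ('E_P[fun w => (f w + g w)%R] = 'E_P[f] + 'E_P[g])%E.
Proof.
move=> mf mg f0 g0; rewrite unlock; under eq_integral do rewrite EFinD.
by rewrite ge0_integralD //; try (by apply/measurable_EFinP); move=> w _; rewrite lee_fin.
Qed.

Lemma ge0_expectationZl f (k : R) : measurable_fun setT f ->
  (forall w, 0 <= f w) -> 0 <= k ->
  ('E_P[fun w => (k * f w)%R] = k%:E * 'E_P[f])%E.
Proof.
move=> mf f0 k0; rewrite unlock; under eq_integral do rewrite EFinM.
rewrite ge0_integralZl_EFin //; last exact/measurable_EFinP.
by move=> w _; rewrite lee_fin.
Qed.

Lemma ge0_expectation_sum (I : Type) (s : seq I) (f : I -> Omega -> R) :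
  (forall i, measurable_fun setT (f i)) -> (forall i w, 0 <= f i w) ->
  ('E_P[fun w => (\sum_(i <- s) f i w)%R] = \sum_(i <- s) 'E_P[f i])%E.
Proof.
move=> mf f0; rewrite unlock; under eq_integral do rewrite -sumEFin.
rewrite ge0_integral_sum // => i; first exact/measurable_EFinP.
by move=> w _; rewrite lee_fin.
Qed.

Lemma ge0_expectation_le f g : measurable_fun setT f -> measurable_fun setT g ->
  (forall w, 0 <= f w) -> (forall w, f w <= g w) -> ('E_P[f] <= 'E_P[g])%E.
Proof.
move=> mf mg f0 fg; apply: expectation_le => //; last exact: nearW.
by move=> w; exact: le_trans (fg w).
Qed.

Lemma expectation_expRN_ge f (t : R) : measurable_fun setT f ->
  (forall w, 0 <= f w) -> ('E_P[f] = t%:E)%E ->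
  ((expR (- t))%:E <= 'E_P[fun w => expR (- f w)])%E.
Proof.
move=> mf f0 Ef.
have t0 : 0 <= t by rewrite -lee_fin -Ef; exact: expectation_ge0.
have me : measurable_fun setT (fun w => expR (- f w)).
  by apply: measurableT_comp => //; exact: measurableT_comp.
(* The tangent of exp(-s) at [t], with its negative term moved to the other side: every expectation
   involved is then of a nonnegative function. *)
have : ('E_P[cst (expR (- t) * (1 + t))%R] <=
    'E_P[fun w => (expR (- f w) + expR (- t) * f w)%R])%E.
  apply: ge0_expectation_le => //.
  - by apply: measurable_funD => //; exact: measurable_funM.
  - by move=> w; rewrite mulr_ge0 ?expR_ge0 ?addr_ge0.
  - move=> w /=; rewrite -lerBlDr -mulrBr addrAC.
    rewrite (_ : - f w = - t + (t - f w)); last by ring.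
    rewrite expRD ler_pM2l ?expR_gt0 //.
    by apply: le_trans (expR_ge1Dx _); lra.
rewrite expectation_cst ge0_expectationD //; last 2 first.
- exact: measurable_funM.
- by move=> w; rewrite mulr_ge0 ?expR_ge0.
rewrite ge0_expectationZl ?expR_ge0 // Ef -EFinM.
by rewrite mulrDr mulr1 EFinD leeD2rE.
Qed.

End ge0_expectation.

Section upper_bound.
Variables (dO dW : measure_display) (Omega : measurableType dO).
Variables (W : measurableType dW) (R : realType).
Variables (P : probability Omega R) (Q : probability W R).
Variables (d : nat) (S : nat -> W -> 'rV[int]_d) (s0 : 'I_d * bool).
Hypothesis hS : simple_random_walk Q S.
Variables (U : 'rV[int]_d -> Omega -> R) (mu : R).
Hypothesis mU : forall x, measurable_fun setT (U x).
Hypothesis U_ge0 : forall x w, 0 <= U x w.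
Hypothesis EU : forall x, ('E_P[U x] = mu%:E)%E.

Let d_gt0 : (0 < d)%N. Proof. by case: s0 => -[]; case: (d). Qed.

Let mu_ge0 : 0 <= mu.
Proof. by rewrite -lee_fin -(EU 0); exact: expectation_ge0. Qed.

Lemma measurable_walk_survival y n x :
  measurable_fun setT (fun w => walk_survival (U ^~ w) y n x).
Proof.
elim: n x => [|n IH] x /=; case: (x == y) => //.
apply: measurable_funM; first by apply: measurableT_comp => //; exact: measurableT_comp.
by apply: measurable_funM => //; exact: measurable_sum.
Qed.

Lemma measurable_survival y : measurable_fun setT (fun w => survival Q S (U ^~ w) y).
Proof.
apply: (measurable_fun_cvg (fun n => measurable_walk_survival y n 0)) => w _.
exact: (walk_survival_cvg d_gt0 hS (U_ge0 ^~ w)).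
Qed.

Lemma walk_survival_le_survival w y n :
  walk_survival (U ^~ w) y n 0 <= survival Q S (U ^~ w) y.
Proof.
apply: (cvgr_to_ge (walk_survival_cvg d_gt0 hS (U_ge0 ^~ w))).
by exists n => // m /= nm; apply: walk_survival_le.
Qed.

Lemma walk_survival_le1 (u : 'rV[int]_d -> R) y n x : (forall x, 0 <= u x) ->
  walk_survival u y n x <= 1.
Proof.
move=> u0; elim: n x => [|n IH] x /=; case: ifP => _ //.
rewrite mulr_ile1 ?expR_ge0 ?expR_le1 ?oppr_le0 //.
  by rewrite mulr_ge0 ?sumr_ge0 // => s _; exact: walk_survival_ge0.
rewrite mulrC ler_pdivrMr ?ltr0n ?muln_gt0 // mul1r.
apply: (@le_trans _ _ (\sum_(s : 'I_d * bool) 1)); first by apply: ler_sum.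
by rewrite sumr_const card_prod card_ord card_bool mulnC.
Qed.

Lemma survival_le1 w y : survival Q S (U ^~ w) y <= 1.
Proof.
apply: (cvgr_to_le (walk_survival_cvg d_gt0 hS (U_ge0 ^~ w))).
by apply: nearW => n; exact: walk_survival_le1.
Qed.

Section cost.
Variables (q : 'I_d * bool -> R) (c : R).
Hypothesis q_gt0 : forall s, 0 < q s.
Hypothesis q_sum1 : \sum_s q s = 1.
Hypothesis c_ge0 : 0 <= c.
Hypothesis entropy_le : \sum_s q s * ln ((2 * d)%N%:R * q s) <= c.

(** The path depends on [x] and [y] but not on the environment, so the cost is affine in the
    potential and its mean is the cost in the constant potential [mu]. The same holds for
    [tilted_cost]. *)
Lemma straight_cost_expectation y k x :
  measurable_fun setT (fun w => straight_cost s0 y (U ^~ w) k x) /\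
  ('E_P[fun w => straight_cost s0 y (U ^~ w) k x] =
   (straight_cost s0 y (fun=> mu) k x)%:E)%E.
Proof.
elim: k x => [|k IH] x /=; first by split => //; exact: expectation_cst.
case: (x == y); first by split => //; exact: expectation_cst.
have [m e] := IH (x + step (step_toward y x s0)).
split; first by apply: measurable_funD => //; exact: measurable_funD.
have logd_ge0 : 0 <= ln (2 * d)%N%:R :> R by apply: ln_ge0; rewrite ler1n; lia.
rewrite ge0_expectationD //; last 3 first.
- exact: measurable_funD.
- by move=> w; rewrite addr_ge0.
- by move=> w; exact: straight_cost_ge0.
by rewrite e ge0_expectationD // EU expectation_cst.
Qed.

Lemma tilted_cost_expectation y n x :
  measurable_fun setT (fun w => tilted_cost s0 y q c (U ^~ w) n x) /\
  ('E_P[fun w => tilted_cost s0 y q c (U ^~ w) n x] =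
   (tilted_cost s0 y q c (fun=> mu) n x)%:E)%E.
Proof.
elim: n x => [|n IH] x /=; first exact: straight_cost_expectation.
have mq s : measurable_fun setT (fun w => q s * tilted_cost s0 y q c (U ^~ w) n (x + step s)).
  by apply: measurable_funM => //; exact: (IH _).1.
have q0 s w : 0 <= q s * tilted_cost s0 y q c (U ^~ w) n (x + step s).
  by rewrite mulr_ge0 ?tilted_cost_ge0 // ltW.
split; first by apply: measurable_funD; [exact: measurable_funD|exact: measurable_sum].
rewrite ge0_expectationD //; last 4 first.
- exact: measurable_funD.
- exact: measurable_sum.
- by move=> w; rewrite addr_ge0.
- by move=> w; rewrite sumr_ge0.
rewrite ge0_expectationD // EU expectation_cst ge0_expectation_sum //.
rewrite (eq_bigr (fun s => (q s * tilted_cost s0 y q c (fun=> mu) n (x + step s))%:E)).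
  by rewrite sumEFin.
move=> s _; have [mt et] := IH (x + step s).
rewrite -[LHS]/('E_P[fun w => (q s * tilted_cost s0 y q c (U ^~ w) n (x + step s))%R])%E.
rewrite ge0_expectationZl ?et ?ltW // => w; exact: tilted_cost_ge0.
Qed.

Lemma survival_ge_tilted w y n :
  expR (- tilted_cost s0 y q c (U ^~ w) n 0) <= survival Q S (U ^~ w) y.
Proof.
apply: le_trans (walk_survival_le_survival w y (norm1 (0 - y)%R + 2 * n)).
by apply: (walk_survival_ge_tilted s0 q_gt0 q_sum1 c_ge0 entropy_le).
Qed.

(** Keeps [ln] away from its default value at nonpositive arguments. *)
Lemma survival_gt0 w y : 0 < survival Q S (U ^~ w) y.
Proof. exact: lt_le_trans (expR_gt0 _) (survival_ge_tilted w y 0). Qed.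

Definition log_cost y w := - ln (survival Q S (U ^~ w) y).

Lemma log_cost_ge0 y w : 0 <= log_cost y w.
Proof. by rewrite oppr_ge0; apply: ln_le0; exact: survival_le1. Qed.

Lemma measurable_log_cost y : measurable_fun setT (log_cost y).
Proof.
apply: measurableT_comp => //; apply: measurableT_comp => //.
exact: measurable_survival.
Qed.

Lemma log_cost_le y w n : log_cost y w <= tilted_cost s0 y q c (U ^~ w) n 0.
Proof.
rewrite lerNl -[leLHS]expRK ler_ln ?posrE ?expR_gt0 ?survival_gt0 //.
exact: survival_ge_tilted.
Qed.

Lemma expectation_log_cost_le y n :
  ('E_P[log_cost y] <= (tilted_cost s0 y q c (fun=> mu) n 0)%:E)%E.
Proof.
rewrite -(tilted_cost_expectation y n 0).2; apply: ge0_expectation_le.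
- exact: measurable_log_cost.
- exact: (tilted_cost_expectation y n 0).1.
- exact: log_cost_ge0.
- by move=> w; exact: log_cost_le.
Qed.

Lemma expectation_log_cost_fin y : ('E_P[log_cost y] \is a fin_num)%E.
Proof.
rewrite ge0_fin_numE; last by apply: expectation_ge0; exact: log_cost_ge0.
exact: le_lt_trans (expectation_log_cost_le y 0) (ltry _).
Qed.

Lemma expectation_survival_ge y :
  ((expR (- fine 'E_P[log_cost y]))%:E <= 'E_P[fun w => survival Q S (U ^~ w) y])%E.
Proof.
have -> : (fun w => survival Q S (U ^~ w) y) = (fun w => expR (- log_cost y w)).
  by apply/funext => w; rewrite /log_cost opprK lnK // posrE survival_gt0.
apply: expectation_expRN_ge.
- exact: measurable_log_cost.
- exact: log_cost_ge0.
- by rewrite fineK // expectation_log_cost_fin.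
Qed.

Lemma expectation_ln_survival y k : ((- k%:R^-1)%:E *
    'E_P[fun w => ln (survival Q S (U ^~ w) y)] =
  (k%:R^-1 * fine 'E_P[log_cost y])%:E)%E.
Proof.
have -> : ('E_P[fun w => ln (survival Q S (U ^~ w) y)] = - 'E_P[log_cost y])%E.
  rewrite unlock -integral_ge0N; last by move=> w _; rewrite lee_fin log_cost_ge0.
  by apply: eq_integral => w _; rewrite /log_cost EFinN oppeK.
by rewrite EFinM (fineK (expectation_log_cost_fin y)) EFinN mulNe muleN oppeK.
Qed.

(** Since [p] tilted steps have mean displacement exactly [l], [k * p] steps aim exactly at
    [l *+ k], and the squared distance term vanishes. Dividing by k and then letting eta tend to 0
    leaves energy plus entropy per step. *)
Lemma quenched_le_entropy (a : 'rV[R]_d -> R) (l : 'rV[int]_d) (p : nat) :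
  quenched_lyapunov P Q S U a ->
  (forall i, p%:R * drift q i = (l 0 i)%:~R) ->
  a (int_vec R l) <= p%:R * (mu + c).
Proof.
case=> _ _ /(_ l) cvg_a hdrift.
have logd_ge0 : 0 <= ln (2 * d)%N%:R :> R by apply: ln_ge0; rewrite ler1n; lia.
set C := mu + ln (2 * d)%N%:R.
have C0 : 0 <= C by rewrite addr_ge0.
have bound eta : 0 < eta -> a (int_vec R l) <= p%:R * (mu + c + C * eta) + eta.
  move=> eta0; rewrite -lee_fin; apply: (cvge_to_le cvg_a).
  (* Beyond this threshold the constant error C d / eta is at most k eta. *)
  pose K := Num.truncn (C * d%:R / eta ^+ 2).
  exists K.+1 => // k /= kK.
  have k0 : 0 < k%:R :> R by rewrite ltr0n; exact: leq_ltn_trans kK.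
  rewrite expectation_ln_survival lee_fin ler_pdivrMl //.
  rewrite -lee_fin fineK ?expectation_log_cost_fin //.
  apply: (le_trans (expectation_log_cost_le _ (k * p))); rewrite lee_fin.
  have := tilted_cost_const s0 (l *+ k) c q_gt0 q_sum1 (k * p) 0 mu_ge0 eta0; rewrite /= => h; apply: (le_trans h).
  have -> : sqdist (l *+ k) q (k * p) 0 = 0.
    apply: big1 => i _; rewrite natrM -mulrA hdrift mxE.
    by rewrite mulmxnE sub0r rmorphN rmorphMn /= -mulr_natl addNr expr0n.
  rewrite mulr0 addr0 natrM -/C [leRHS]mulrDr [k%:R * (p%:R * _)]mulrA lerD2l.
  rewrite ler_pdivrMr // -mulrA -expr2 -ler_pdivrMr ?exprn_gt0 //.
  apply: ltW; apply: lt_le_trans (truncnS_gt _) _.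
  by rewrite ler_nat.
apply/ler_addgt0Pr => e e0.
have D0 : 0 < p%:R * C + 1 by rewrite ltr_wpDl // mulr_ge0.
(* With this [eta] the two errors p C eta and eta add up to [e]. *)
have := bound (e / (p%:R * C + 1)); rewrite divr_gt0 // => /(_ isT) h.
apply: (le_trans h).
have -> : p%:R * (mu + c + C * (e / (p%:R * C + 1))) + e / (p%:R * C + 1) = p%:R * (mu + c) + e.
  by field; rewrite gt_eqF.
by [].
Qed.

End cost.

Lemma expectation_survival_fin y : ('E_P[fun w => survival Q S (U ^~ w) y] \is a fin_num)%E.
Proof.
have s_ge0 w : 0 <= survival Q S (U ^~ w) y.
  exact: le_trans (walk_survival_ge0 _ _ _ _) (walk_survival_le_survival w y 0).
rewrite ge0_fin_numE; last exact: expectation_ge0.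
have : ('E_P[fun w => survival Q S (U ^~ w) y] <= 'E_P[cst 1%R])%E.
  apply: ge0_expectation_le => //; first exact: measurable_survival.
  by move=> w; exact: survival_le1.
by rewrite expectation_cst => /le_lt_trans; apply; exact: ltry.
Qed.

(** A law of zero entropy, to instantiate those results of the preceding section whose conclusions
    do not mention [q] or [c]. *)
Let unif (s : 'I_d * bool) : R := (2 * d)%N%:R^-1.

Let D_gt0 : 0 < (2 * d)%N%:R :> R. Proof. by rewrite ltr0n muln_gt0. Qed.

Let unif_gt0 s : 0 < unif s. Proof. by rewrite invr_gt0. Qed.

Let unif_sum1 : \sum_s unif s = 1.
Proof.
rewrite sumr_const card_prod card_ord card_bool (mulnC d) /unif.
by rewrite -[RHS](mulfV (lt0r_neq0 D_gt0)) [RHS]mulr_natl.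
Qed.

Let unif_entropy : \sum_s unif s * ln ((2 * d)%N%:R * unif s) <= 0.
Proof. by rewrite big1 // => s _; rewrite /unif mulfV ?gt_eqF // ln1 mulr0. Qed.

Lemma fine_expectation_survival_ge y : expR (- fine 'E_P[log_cost y]) <=
  fine 'E_P[fun w => survival Q S (U ^~ w) y].
Proof.
have := expectation_survival_ge unif_gt0 unif_sum1 (lexx 0) unif_entropy y.
by rewrite -(fineK (expectation_survival_fin _)) lee_fin.
Qed.

Lemma annealed_le_quenched (a b : 'rV[R]_d -> R) (l : 'rV[int]_d) :
  quenched_lyapunov P Q S U a -> annealed_lyapunov P Q S U b ->
  b (int_vec R l) <= a (int_vec R l).
Proof.
case=> _ _ /(_ l) cvg_a [_ /(_ l) cvg_b].
have := cvg_a; under eq_fun do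
  rewrite (expectation_ln_survival unif_gt0 unif_sum1 (lexx 0) unif_entropy).
move=> /fine_cvg /=.
set f := (fun k : nat => _) => cvg_a'.
apply: (ler_cvg_to cvg_b cvg_a'); apply: nearW => k.
rewrite /f mulNr -mulrN; apply: ler_wpM2l => //.
have Ege := fine_expectation_survival_ge (l *+ k).
by rewrite lerNl -[leLHS]expRK ler_ln ?posrE ?expR_gt0 // (lt_le_trans (expR_gt0 _) Ege).
Qed.

End upper_bound.

(** * Superharmonic functions of the height *)

Section step_average.
Variables (R : realType) (d : nat).
Hypothesis d_gt0 : (0 < d)%N.

Definition step_avg (F : 'I_d * bool -> R) : R := (2 * d)%N%:R^-1 * \sum_s F s.

Lemma step_avgD F G : step_avg (fun s => F s + G s) = step_avg F + step_avg G.
Proof. by rewrite /step_avg big_split mulrDr. Qed.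

Lemma step_avgZ k F : step_avg (fun s => k * F s) = k * step_avg F.
Proof. by rewrite /step_avg -mulr_sumr mulrCA. Qed.

Lemma step_avg_sum (I : Type) (r : seq I) (F : I -> 'I_d * bool -> R) :
  step_avg (fun s => \sum_(i <- r) F i s) = \sum_(i <- r) step_avg (F i).
Proof. by rewrite /step_avg exchange_big mulr_sumr. Qed.

Lemma step_avg_le F G : (forall s, F s <= G s) -> step_avg F <= step_avg G.
Proof. by move=> FG; apply: ler_wpM2l => //; exact: ler_sum. Qed.

Lemma step_avg_cst k : step_avg (fun=> k) = k.
Proof.
rewrite /step_avg sumr_const card_prod card_ord card_bool (mulnC d) -[X in _ * X]mulr_natl mulrA.
by rewrite mulVf ?mul1r // pnatr_eq0 muln_eq0 -lt0n.
Qed.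

Lemma step_avg_dir F : step_avg F = d%:R^-1 * \sum_i (F (i, true) + F (i, false)) / 2.
Proof.
rewrite /step_avg sum_dir -mulr_suml natrM invfM; ring.
Qed.

Lemma avg_dir_le (F : 'I_d -> R) (e : 'I_d -> R) (k : R) :
  (forall i, F i <= 1 + e i ^+ 2 * k) -> \sum_i e i ^+ 2 = 1 ->
  d%:R^-1 * \sum_i F i <= 1 + k / d%:R.
Proof.
move=> Fle e1.
have d0 : 0 < d%:R :> R by rewrite ltr0n.
rewrite ler_pdivrMl // mulrDr mulr1 mulrCA mulfV ?gt_eqF // mulr1.
apply: (le_trans (ler_sum _ (fun i _ => Fle i))).
by rewrite big_split /= sumr_const card_ord -mulr_suml e1 mul1r.
Qed.

End step_average.

Section slab.
Variables (R : realType) (d : nat).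
Hypothesis d_gt0 : (0 < d)%N.
Variable e : 'I_d -> R.
Hypothesis e_unit : \sum_i e i ^+ 2 = 1.

Definition height (x : 'rV[int]_d) : R := \sum_i e i * (x 0 i)%:~R.

Definition rise (s : 'I_d * bool) : R := if s.2 then - e s.1 else e s.1.

Lemma height_step x s : height (x + step s) = height x + rise s.
Proof.
rewrite /height (bigD1 s.1) //= [in RHS](bigD1 s.1) //=.
rewrite (eq_bigr (fun i => e i * (x 0 i)%:~R)); last first.
  by move=> i is1; rewrite mxE stepE eq_sym (negPf is1) addr0.
by rewrite mxE stepE eqxx rmorphD /= /rise; case: s => i [] /=; ring.
Qed.

Lemma height0 : height 0 = 0.
Proof. by rewrite /height big1 // => i _; rewrite mxE mulr0. Qed.

Let e_sqr_le1 i : e i ^+ 2 <= 1.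
Proof. by rewrite -e_unit (bigD1 i) //= lerDl sumr_ge0 // => j _; exact: sqr_ge0. Qed.

Let e_bound i : -1 <= e i <= 1.
Proof. by have := e_sqr_le1 i; nra. Qed.

Lemma rise_bound s : -1 <= rise s <= 1.
Proof. by have := e_bound s.1; rewrite /rise; case: s.2; lra. Qed.

Let d0 : 0 < d%:R :> R. Proof. by rewrite ltr0n. Qed.

Lemma convex_le_step_avg (f : R -> R) u :
  (forall h, 2 * f u <= f (u - h) + f (u + h)) -> f u <= step_avg (fun s => f (u + rise s)).
Proof.
move=> fconv; rewrite step_avg_dir ler_pdivlMl //.
have -> : d%:R * f u = \sum_(i < d) f u by rewrite sumr_const card_ord mulr_natl.
by apply: ler_sum => i _; rewrite /rise /=; have := fconv (e i); lra.
Qed.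

Definition pospart (u : R) := Num.max u 0.

Lemma pospart_ge0 u : 0 <= pospart u. Proof. by rewrite /pospart le_max lexx orbT. Qed.

Lemma pospart_pos u : 0 <= u -> pospart u = u.
Proof. by move=> u0; rewrite /pospart max_l. Qed.

Lemma pospart_neg u : u <= 0 -> pospart u = 0.
Proof. by move=> u0; rewrite /pospart max_r. Qed.

Lemma pospart_ge u : u <= pospart u. Proof. by rewrite /pospart le_max lexx. Qed.

Lemma pospart_homo u v : u <= v -> pospart u <= pospart v.
Proof. by move=> uv; rewrite /pospart ge_max !le_max uv lexx orbT. Qed.

Lemma pospart_convex u h : 2 * pospart u <= pospart (u - h) + pospart (u + h).
Proof.
have := pospart_ge (u - h); have := pospart_ge (u + h).
have := pospart_ge0 (u - h); have := pospart_ge0 (u + h).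
by rewrite {5}/pospart /Num.max; case: ltrP; lra.
Qed.

Lemma sqr_pospart_convex u h :
  2 * pospart u ^+ 2 <= pospart (u - h) ^+ 2 + pospart (u + h) ^+ 2.
Proof.
have := pospart_convex u h; have := pospart_ge0 u.
have := pospart_ge0 (u - h); have := pospart_ge0 (u + h).
set a := pospart u; set b := pospart (u - h); set c := pospart (u + h).
move=> c0 b0 a0 abc; have := sqr_ge0 (b - c).
have : 0 <= (b + c - 2 * a) * (b + c + 2 * a) by apply: mulr_ge0; lra.
lra.
Qed.

Variables (lam kap L : R) (N : nat).
Hypothesis lam_ge0 : 0 <= lam.
Hypothesis kap_ge0 : 0 <= kap.
Hypothesis kapE : kap ^+ 2 * (1 + d%:R * lam) = 2 * d%:R * lam.
Hypothesis L_ge1 : 1 <= L.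

(** By [cosh_mul_le1] the left side is at most 1/(1 - kap^2 t^2 / 2), which is convex in t^2. By
    [kapE] its chord between t^2 = 0 and t^2 = 1 is the right side. *)
Lemma cosh_kap_le t : t ^+ 2 <= 1 -> cosh (kap * t) <= 1 + t ^+ 2 * (d%:R * lam).
Proof.
move=> t1; have := cosh_mul_le1 (kap * t); have := cosh_ge1 (kap * t).
move: (cosh _) => c c1; rewrite exprMn => h.
have D0 : 0 <= d%:R * lam by rewrite mulr_ge0 // ltW.
have k2 : kap ^+ 2 / 2 = d%:R * lam / (1 + d%:R * lam).
  rewrite -(mulfK (_ : 1 + d%:R * lam != 0) (kap ^+ 2 / 2)); last by rewrite gt_eqF //; lra.
  congr (_ / _); have := kapE. by lra.
have t0 := sqr_ge0 t.
have p : 0 < 1 - kap ^+ 2 * t ^+ 2 / 2.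
  have -> : 1 - kap ^+ 2 * t ^+ 2 / 2 = (1 + d%:R * lam * (1 - t ^+ 2)) / (1 + d%:R * lam).
    rewrite mulrAC k2; field; rewrite gt_eqF //; lra.
  by rewrite divr_gt0 ?ltr_wpDr ?mulr_ge0 //; lra.
rewrite -(ler_pM2r p); apply: (le_trans h).
have -> : (1 + t ^+ 2 * (d%:R * lam)) * (1 - kap ^+ 2 * t ^+ 2 / 2) =
  1 + d%:R * lam * (d%:R * lam) * t ^+ 2 * (1 - t ^+ 2) / (1 + d%:R * lam).
  rewrite [kap ^+ 2 * _ / 2]mulrAC k2; field; rewrite gt_eqF //; lra.
rewrite lerDl; apply: divr_ge0; last lra.
by apply: mulr_ge0; [apply: mulr_ge0 => //; exact: mulr_ge0|lra].
Qed.

(** Opposite steps combine by the addition formula, and since [e] is a unit vector the average of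
    cosh(kap e_i) is at most 1 + lam. So killing at rate lam makes cosh(kap height)
    superharmonic. *)
Lemma step_avg_cosh_le u : step_avg (fun s => cosh (kap * (u + rise s))) <=
  expR lam * cosh (kap * u).
Proof.
rewrite step_avg_dir.
rewrite (eq_bigr (fun i => cosh (kap * u) * cosh (kap * e i))); last first.
  move=> i _; rewrite /rise /= addrC mulrDr [in X in _ + X]mulrDr mulrN coshD_avg.
  by field.
rewrite -mulr_sumr mulrCA mulrC; apply: ler_wpM2r.
  exact: le_trans ler01 (cosh_ge1 _).
apply: (@le_trans _ _ (1 + (d%:R * lam) / d%:R)).
  apply: (avg_dir_le d_gt0 _ e_unit) => i; exact: cosh_kap_le.
by rewrite mulrAC mulfV ?gt_eqF // mul1r expR_ge1Dx.
Qed.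

(** Below the slab nothing is charged, so the function has to be flat there, even after a unit step
    into the slab: this explains [u - 1]. The same shift absorbs the overshoot when a slab is
    entered. The denominator normalises the value at the exit. *)
Definition decay (u : R) : R := cosh (kap * pospart (u - 1)) / cosh (kap * (L - 1)).

Let coshL_gt0 : 0 < cosh (kap * (L - 1)).
Proof. exact: lt_le_trans ltr01 (cosh_ge1 _). Qed.

Lemma decay_ge0 u : 0 <= decay u.
Proof. by rewrite divr_ge0 // ?(le_trans ler01 (cosh_ge1 _)) // ltW. Qed.

Lemma decay_low u : u <= 1 -> decay u = (cosh (kap * (L - 1)))^-1.
Proof. by move=> u1; rewrite /decay pospart_neg ?mulr0 ?cosh0 ?mul1r //; lra. Qed.

Lemma decay_exit u : L <= u -> 1 <= decay u.
Proof.
move=> Lu; rewrite /decay ler_pdivlMr // mul1r; apply: cosh_homo.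
  by rewrite mulr_ge0 // subr_ge0.
by apply: ler_wpM2l => //; apply: le_trans (pospart_ge _); rewrite lerD2r.
Qed.

Let cosh_pospart_le t : cosh (kap * pospart t) <= cosh (kap * t).
Proof.
case: (lerP 0 t) => t0; first by rewrite pospart_pos.
rewrite pospart_neg ?(ltW t0) // mulr0 cosh0; exact: cosh_ge1.
Qed.

Lemma decay_step_low u : u < 0 -> step_avg (fun s => decay (u + rise s)) <= decay u.
Proof.
move=> u0; rewrite [leRHS]decay_low; last lra.
rewrite -[leRHS](step_avg_cst d_gt0); apply: step_avg_le => s.
by rewrite decay_low //; have := rise_bound s; lra.
Qed.

Lemma decay_step u : 0 <= u ->
  expR (- lam) * step_avg (fun s => decay (u + rise s)) <= decay u.
Proof.
move=> u0; rewrite expRN ler_pdivrMl ?expR_gt0 //.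
rewrite /decay; under [X in step_avg X]eq_fun do rewrite mulrC.
rewrite step_avgZ [leRHS]mulrA [leRHS]mulrC; apply: ler_wpM2l; first by rewrite invr_ge0 ltW.
case: (lerP 1 u) => u1.
  rewrite [in leRHS]pospart_pos; last lra.
  apply: le_trans (step_avg_cosh_le (u - 1)).
  by apply: step_avg_le => s; rewrite addrAC.
(* For 0 <= u < 1 the value equals the one at u = 1, and a step from u leads no higher than the same
   step from 1; there the flattening only lowers [cosh]. *)
rewrite [in leRHS]pospart_neg ?mulr0; last lra.
rewrite -[X in cosh X](mulr0 kap).
apply: le_trans (step_avg_cosh_le 0).
apply: step_avg_le => s; rewrite add0r.
apply: le_trans (cosh_pospart_le _); apply: cosh_homo.
  by rewrite mulr_ge0 ?pospart_ge0.
by apply: ler_wpM2l => //; apply: pospart_homo; lra.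
Qed.

(** A concave function of the height above a site: 2 at or below that height, decreasing to 1 at the
    largest possible overshoot L + 1. It is superharmonic, with a strict loss at the site itself, so
    it can pay for each visit. *)
Definition pull (w : R) : R := 2 - pospart w / (L + 1).

Definition rho : R := 1 - (4 * d%:R * (L + 1))^-1.

Let L1_gt0 : 0 < L + 1. Proof. by have := L_ge1; lra. Qed.

Lemma rho_ge0 : 0 <= rho.
Proof.
rewrite subr_ge0 invf_le1 ?mulr_gt0 //.
have d1 : 1 <= d%:R :> R by rewrite ler1n.
by have := L_ge1; nra.
Qed.

Lemma rho_le1 : rho <= 1.
Proof. by rewrite gerBl invr_ge0 !mulr_ge0 // ltW. Qed.

Lemma pull_ge1 w : w <= L + 1 -> 1 <= pull w.
Proof.
move=> wL; rewrite /pull lerBrDl -lerBrDr ler_pdivrMr //.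
rewrite (_ : 2 - 1 = 1) ?mul1r; last by ring.
by rewrite /pospart ge_max wL ltW.
Qed.

Let step_avg_pull (f : 'I_d * bool -> R) :
  step_avg (fun s => pull (f s)) = 2 - step_avg (fun s => pospart (f s)) / (L + 1).
Proof.
rewrite /pull; under [X in step_avg X]eq_fun do rewrite mulrC -mulNr.
by rewrite step_avgD step_avg_cst // step_avgZ mulNr mulrC.
Qed.

Lemma pull_step w : step_avg (fun s => pull (w + rise s)) <= pull w.
Proof.
rewrite step_avg_pull lerD2l lerN2 ler_pM2r ?invr_gt0 //.
exact: convex_le_step_avg (pospart_convex w).
Qed.

(** The mean of the positive part of a step is the sum of the |e_i| over 2d, at least 1/(2d) because
    |e_i| >= e_i^2. Divided by L + 1 and compared with the value 2 of [pull], it gives the gap 1/(4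
    d (L + 1)) in [rho]. *)
Lemma pull_step0 : step_avg (fun s => pull (rise s)) <= rho * 2.
Proof.
rewrite step_avg_pull /rho mulrBl mul1r lerD2l lerN2.
have -> : (4 * d%:R * (L + 1))^-1 * 2 = (d%:R^-1 * (2^-1)) / (L + 1) :> R.
  by field; rewrite !gt_eqF.
rewrite ler_pM2r ?invr_gt0 // step_avg_dir ler_pM2l ?invr_gt0 //.
rewrite -mulr_suml -{1}[2^-1]mul1r ler_pM2r ?invr_gt0 // -{1}e_unit.
apply: ler_sum => i _; rewrite /rise /=; have := e_bound i.
have := pospart_ge0 (e i); have := pospart_ge0 (- e i).
have := pospart_ge (e i); have := pospart_ge (- e i).
move: (pospart _) (pospart _) => a b; nra.
Qed.

(** As [rise] has mean square 1/d, d (u + 1)^2 grows by 1 per step on average, so this bounds the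
    expected time left in the slab. The shift by 1 keeps the positive part inactive after a step
    from u >= 0; L + 2 keeps the budget nonnegative up to the overshoot. *)
Definition budget (u : R) : R := d%:R * ((L + 2) ^+ 2 - pospart (u + 1) ^+ 2).

Let step_avg_budget u : step_avg (fun s => budget (u + rise s)) =
  d%:R * ((L + 2) ^+ 2 - step_avg (fun s => pospart (u + 1 + rise s) ^+ 2)).
Proof.
rewrite /budget step_avgZ step_avgD step_avg_cst //; congr (_ * (_ + _)).
rewrite -mulN1r -step_avgZ; congr step_avg; apply/funext => s.
by rewrite mulN1r addrAC.
Qed.

Lemma budget_step_low u : step_avg (fun s => budget (u + rise s)) <= budget u.
Proof.
rewrite step_avg_budget ler_pM2l // lerD2l lerN2.
exact: (convex_le_step_avg (f := fun u => pospart u ^+ 2)) (sqr_pospart_convex (u + 1)).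
Qed.

Lemma budget_step u : 0 <= u ->
  step_avg (fun s => budget (u + rise s)) + 1 <= budget u.
Proof.
move=> u0; rewrite step_avg_budget /budget [in leRHS]pospart_pos; last lra.
have -> : step_avg (fun s => pospart (u + 1 + rise s) ^+ 2) = (u + 1) ^+ 2 + d%:R^-1.
  rewrite step_avg_dir (eq_bigr (fun i => (u + 1) ^+ 2 + e i ^+ 2)); last first.
    move=> i _; have := e_bound i => ei.
    by rewrite /rise /= !pospart_pos; [field|lra..].
  rewrite big_split /= sumr_const card_ord e_unit -mulr_natl.
  by field; rewrite gt_eqF.
rewrite le_eqVlt; apply/orP; left; apply/eqP; field; rewrite gt_eqF //.
Qed.

Lemma budget_ge0 u : u <= L + 1 -> 0 <= budget u.
Proof.
move=> uL; rewrite mulr_ge0 ?subr_ge0 // ler_sqr ?nnegrE ?pospart_ge0 //; last by have := L_ge1; lra.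
by rewrite /pospart ge_max; have := L_ge1 => ?; apply/andP; split; lra.
Qed.

Lemma budget_le u : budget u <= d%:R * (L + 2) ^+ 2.
Proof. by rewrite /budget ler_pM2l // gerBl sqr_ge0. Qed.

(** The price of recording a new site: N - 1 visits remain before saturation and [pull] is at most
    2. *)
Definition site_fee : R := 2 * rho ^+ N.-1.

Lemma site_fee_ge0 : 0 <= site_fee. Proof. by rewrite mulr_ge0 ?exprn_ge0 ?rho_ge0. Qed.

(* Dominates [expR (- lam * truncated_cost N h)] when the walk leaves the slab:
   either no site of [h] is saturated, and the first term does, or some site is,
   and the second term does. The third term pays for the sites still to come. *)
Definition slab_bound (pos : 'rV[int]_d -> R) (h : seq 'rV[int]_d) (x : 'rV[int]_d) : R :=
  expR (- lam * (size h)%:R) * decay (pos x) +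
  \sum_(z <- undup h) rho ^+ (N - count_mem z h) * pull (pos x - pos z) +
  site_fee * budget (pos x).

Section slab_bound.
Variable (pos : 'rV[int]_d -> R).
Hypothesis pos_step : forall x s, pos (x + step s) = pos x + rise s.

Let step_avg_slab_bound h x : step_avg (fun s => slab_bound pos h (x + step s)) =
  expR (- lam * (size h)%:R) * step_avg (fun s => decay (pos x + rise s)) +
  \sum_(z <- undup h) rho ^+ (N - count_mem z h) *
     step_avg (fun s => pull (pos x - pos z + rise s)) +
  site_fee * step_avg (fun s => budget (pos x + rise s)).
Proof.
rewrite /slab_bound !step_avgD -!step_avgZ step_avg_sum; congr (_ + _ + _).
- by congr step_avg; apply/funext => s; rewrite pos_step.
- apply: eq_bigr => z _; rewrite -step_avgZ; congr step_avg; apply/funext => s.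
  by rewrite pos_step addrAC.
- by congr step_avg; apply/funext => s; rewrite pos_step.
Qed.

(** Visits below the slab are not recorded, so [h] does not grow. *)
Lemma slab_bound_step_low h x : pos x < 0 ->
  step_avg (fun s => slab_bound pos h (x + step s)) <= slab_bound pos h x.
Proof.
move=> x0; rewrite step_avg_slab_bound /slab_bound; apply: lerD; first apply: lerD.
- by rewrite ler_pM2l ?expR_gt0 //; exact: decay_step_low.
- apply: ler_sum => z _; apply: ler_wpM2l; last exact: pull_step.
  by rewrite exprn_ge0 ?rho_ge0.
- by apply: ler_wpM2l; [exact: site_fee_ge0|exact: budget_step_low].
Qed.

Let rho_exp_le n m : (n <= m)%N -> rho ^+ m <= rho ^+ n.
Proof. by move=> nm; apply: ler_wiXn2l => //; [exact: rho_ge0|exact: rho_le1]. Qed.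

(** The decay term pays for the longer history. A revisited site lowers its own exponent by at most
    one, which is compensated by the factor [rho] of [pull_step0]. A new site opens a term of at
    most [site_fee], paid by the unit drop of [budget]. *)
Lemma slab_bound_step h x : 0 <= pos x ->
  step_avg (fun s => slab_bound pos (x :: h) (x + step s)) <= slab_bound pos h x.
Proof.
move=> x0; rewrite step_avg_slab_bound /slab_bound.
have D1 : expR (- lam * (size (x :: h))%:R) * step_avg (fun s => decay (pos x + rise s)) <=
    expR (- lam * (size h)%:R) * decay (pos x).
  rewrite /= -natr1 mulrDr mulr1 expRD -mulrA ler_pM2l ?expR_gt0 //.
  exact: decay_step.
have rho_term z k : rho ^+ k * step_avg (fun s => pull (pos x - pos z + rise s)) <=
    rho ^+ k * pull (pos x - pos z).
  by apply: ler_wpM2l; [rewrite exprn_ge0 ?rho_ge0|exact: pull_step].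
have rho_new k : rho ^+ k * step_avg (fun s => pull (pos x - pos x + rise s)) <=
    rho ^+ k.+1 * 2.
  rewrite exprSr -mulrA subrr; apply: ler_wpM2l; first by rewrite exprn_ge0 ?rho_ge0.
  by under [X in step_avg X]eq_fun do rewrite add0r; exact: pull_step0.
have [xh|xh] := boolP (x \in h).
  apply: lerD; last by apply: ler_wpM2l; [exact: site_fee_ge0|exact: budget_step_low].
  apply: lerD => //=; rewrite xh.
  rewrite !(bigD1_seq x) ?undup_uniq ?mem_undup //=; apply: lerD.
    rewrite eqxx; apply: (le_trans (rho_new _)).
    rewrite subrr [pull 0](_ : _ = 2); last by rewrite /pull pospart_pos // mul0r subr0.
    apply: ler_wpM2r => //; apply: rho_exp_le; lia.
  apply: ler_sum => z zx; rewrite eq_sym (negPf zx) add0n; exact: rho_term.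
have eta_new : rho ^+ (N - 1) * step_avg (fun s => pull (pos x - pos x + rise s)) <= site_fee.
  apply: (le_trans (rho_new _)); rewrite /site_fee mulrC ler_pM2l //.
  by apply: rho_exp_le; lia.
have D3 : site_fee * step_avg (fun s => budget (pos x + rise s)) + site_fee <= site_fee * budget (pos x).
  by rewrite -{2}[site_fee]mulr1 -mulrDr; apply: ler_wpM2l; [exact: site_fee_ge0|exact: budget_step].
rewrite /= (negPf xh) big_cons eqxx (count_memPn xh) addn0.
have D2 : \sum_(z <- undup h) rho ^+ (N - ((x == z) + count_mem z h)) *
     step_avg (fun s => pull (pos x - pos z + rise s)) <=
   \sum_(z <- undup h) rho ^+ (N - count_mem z h) * pull (pos x - pos z).
  rewrite !big_seq; apply: ler_sum => z; rewrite mem_undup => zh.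
  have -> : (x == z) = false by apply: contraNF xh => /eqP ->.
  by rewrite add0n; exact: rho_term.
rewrite /= in D1; have := lerD (lerD D1 D2) (le_trans (lerD (lexx _) eta_new) D3).
by apply: le_trans; rewrite le_eqVlt; apply/orP; left; apply/eqP; ring.
Qed.

End slab_bound.
End slab.

(** * Slab decomposition *)

(** Counted visit by visit, latest first, so that prepending a site changes the cost by 0 or 1;
    [truncated_cost_sum] recovers the sum over sites of the capped local time. *)
Fixpoint truncated_cost (T : eqType) (N : nat) (h : seq T) : nat :=
  if h is x :: h' then (truncated_cost N h' + (count_mem x h' < N))%N else 0%N.

Lemma truncated_cost_unsaturated (T : eqType) (N : nat) (h : seq T) :
  truncated_cost N h = size h \/ exists2 z, z \in h & (N <= count_mem z h)%N.
Proof.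
elim: h => [|x h [IH|[z zh zN]]]; first by left.
  case: (ltnP (count_mem x h) N) => xN; first by left; rewrite /= IH xN addn1.
  by right; exists x; [exact: mem_head|rewrite /= eqxx; lia].
by right; exists z; [rewrite inE zh orbT|rewrite /=; lia].
Qed.

Lemma truncated_cost_sum (T : eqType) (N : nat) (h : seq T) :
  truncated_cost N h = (\sum_(z <- undup h) minn (count_mem z h) N)%N.
Proof.
elim: h => [|x h IH]; first by rewrite big_nil.
rewrite /= IH; have [xh|xh] := boolP (x \in h); last first.
  rewrite big_cons eqxx (count_memPn xh) addnC; congr (_ + _)%N; first by lia.
  rewrite !big_seq; apply: eq_bigr => z; rewrite mem_undup => zh.
  by have -> : (x == z) = false by apply: contraNF xh => /eqP ->.
rewrite !(bigD1_seq x) ?undup_uniq ?mem_undup //= eqxx.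
rewrite [in RHS](eq_bigr (fun z => minn (count_mem z h) N)) => [|z zx]; first last.
  by rewrite /= eq_sym (negPf zx).
rewrite addnAC; congr (_ + _)%N.
by case: (ltnP (count_mem x h) N) => xN; rewrite ?addn1 ?addn0 /minn; do 2 case: ltnP; lia.
Qed.

(** Sites satisfying [p] do not occur in [h0], so their local times start afresh, and the other
    visits of [h] are left uncharged. This decouples a crossing from its past. *)
Lemma truncated_cost_cat (T : eqType) (N : nat) (p : pred T) (h h0 : seq T) :
  all (predC p) h0 ->
  (truncated_cost N [seq z <- h | p z] + truncated_cost N h0 <= truncated_cost N (h ++ h0))%N.
Proof.
move=> ph0; elim: h => [|x h IH] //=; case: ifP => px /=; last exact: leq_trans IH (leq_addr _ _).
have xh0 : x \notin h0 by apply: contraTN px => /(allP ph0).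
rewrite count_cat (count_memPn xh0) addn0.
suff -> : count_mem x [seq z <- h | p z] = count_mem x h by lia.
rewrite count_filter; apply: eq_count => z /=.
by case: eqP => // ->; rewrite px.
Qed.

Section history.
Variables (R : realType) (d : nat).
Hypothesis d_gt0 : (0 < d)%N.
Variables (lam : R) (N : nat) (y : 'rV[int]_d).
Hypothesis lam_ge0 : 0 <= lam.

Definition history_weight (h : seq 'rV[int]_d) : R :=
  expR (- lam * (truncated_cost N h)%:R).

(* Bounds the annealed weight of the walks that hit [y] from [x] within [n]
   steps; [h] lists the sites visited before. *)
Fixpoint history_bound (n : nat) (h : seq 'rV[int]_d) (x : 'rV[int]_d) : R :=
  if x == y then history_weight h else
  if n is n'.+1 then step_avg (fun s => history_bound n' (x :: h) (x + step s))
  else 0.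

Lemma history_bound_le n h x : history_bound n h x <= history_weight h.
Proof.
elim: n h x => [|n IH] h x /=; case: ifP => // _; first exact: expR_ge0.
rewrite -[leRHS](step_avg_cst d_gt0); apply: step_avg_le => s.
apply: (le_trans (IH _ _)).
by rewrite /history_weight ler_expR ler_wnM2l ?oppr_le0 // ler_nat /= leq_addr.
Qed.

Variable e : 'I_d -> R.
Hypothesis e_unit : \sum_i e i ^+ 2 = 1.
Variables (kap L : R).
Hypothesis kap_ge0 : 0 <= kap.
Hypothesis kapE : kap ^+ 2 * (1 + d%:R * lam) = 2 * d%:R * lam.
Hypothesis L_ge1 : 1 <= L.

Local Notation slab_bound := (slab_bound lam kap L N).

Let slab_bound_terms (pos : 'rV[int]_d -> R) h x : all (fun z => 0 <= pos z) h ->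
  pos x <= L + 1 ->
  [/\ forall z, z \in h -> 1 <= pull L (pos x - pos z),
     0 <= \sum_(z <- undup h) rho d L ^+ (N - count_mem z h) * pull L (pos x - pos z),
     0 <= site_fee d L N * budget d L (pos x) &
     0 <= expR (- lam * (size h)%:R) * decay kap L (pos x)].
Proof.
move=> /allP h0 xL1.
have rho0 k : 0 <= rho d L ^+ k by rewrite exprn_ge0 // (rho_ge0 d_gt0 L_ge1).
have pull1 z : z \in h -> 1 <= pull L (pos x - pos z).
  by move=> /h0 pz; apply: pull_ge1 => //; lra.
split => //.
- rewrite big_seq sumr_ge0 // => z; rewrite mem_undup => zh.
  by rewrite mulr_ge0 // (le_trans ler01) // pull1.
- by rewrite mulr_ge0 ?site_fee_ge0 ?budget_ge0.
- by rewrite mulr_ge0 ?expR_ge0 // decay_ge0.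
Qed.

Lemma slab_bound_ge0 (pos : 'rV[int]_d -> R) h x : all (fun z => 0 <= pos z) h ->
  pos x <= L + 1 -> 0 <= slab_bound pos h x.
Proof. by move=> h0 /(slab_bound_terms h0)[_ S0 B0 D0]; rewrite !addr_ge0. Qed.

Lemma slab_bound_exit (pos : 'rV[int]_d -> R) h x : all (fun z => 0 <= pos z) h ->
  L <= pos x <= L + 1 -> history_weight h <= slab_bound pos h x.
Proof.
move=> h0 /andP[xL /(slab_bound_terms h0)[pull1 S0 B0 D0]].
have rho0 k : 0 <= rho d L ^+ k by rewrite exprn_ge0 // (rho_ge0 d_gt0 L_ge1).
rewrite /slab_bound /history_weight.
case: (truncated_cost_unsaturated N h) => [->|[z zh zN]].
  rewrite -addrA ler_wpDr ?addr_ge0 //.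
  by rewrite -[leLHS]mulr1 ler_pM2l ?expR_gt0 // decay_exit.
(* Some site is saturated: its exponent is 0, so its term alone is [pull], at least 1, whereas a
   weight is at most 1. *)
rewrite -addrA ler_wpDl // ler_wpDr //.
rewrite (bigD1_seq z) ?mem_undup ?undup_uniq //=.
rewrite (_ : (N - _ = 0)%N) ?expr0 ?mul1r; last by apply/eqP; rewrite subn_eq0.
apply: ler_wpDr.
  rewrite big_seq_cond sumr_ge0 // => t; rewrite mem_undup => /andP[th _].
  by rewrite mulr_ge0 // (le_trans ler01) // pull1.
apply: le_trans (pull1 _ zh).
by rewrite expR_le1 mulNr oppr_le0 mulr_ge0.
Qed.

Local Notation height := (height e).

(** A bound for [slab_bound] at the entrance of a slab with nothing recorded: the flat value of
    [decay] and the largest [budget]. *)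
Definition slab_factor : R :=
  (cosh (kap * (L - 1)))^-1 + site_fee d L N * (d%:R * (L + 2) ^+ 2).

Lemma slab_factor_ge0 : 0 <= slab_factor.
Proof.
rewrite addr_ge0 ?invr_ge0 ?(le_trans ler01 (cosh_ge1 _)) //.
by apply: mulr_ge0; [exact: site_fee_ge0|rewrite mulr_ge0 ?sqr_ge0].
Qed.

(** Here [h0] is the past before height [a] is first reached, [h] the visits since then, and [q]
    bounds the cost beyond the slab. The walk may fall back below [a]; the filter drops these
    visits. It leaves the slab with overshoot at most 1, where [next] applies. *)
Lemma history_bound_slab (a q : R) : 0 <= q -> a + L <= height y ->
  (forall n h x, all (fun z => height z < a + L) h ->
     a + L <= height x <= a + L + 1 -> history_bound n h x <= history_weight h * q) ->
  forall n h h0 x, all (fun z => height z < a + L) h ->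
    all (fun z => height z < a) h0 -> height x <= a + L + 1 ->
    history_bound n (h ++ h0) x <= history_weight h0 * q *
      slab_bound (fun z => height z - a) [seq z <- h | a <= height z] x.
Proof.
move=> q0 ay next; set pos := fun z => height z - a.
have pos_step x s : pos (x + step s) = pos x + rise e s.
  by rewrite /pos height_step addrAC.
have w0 h : 0 <= history_weight h by exact: expR_ge0.
have slab_h h : all (fun z => 0 <= pos z) [seq z <- h | a <= height z].
  by apply/allP => z; rewrite mem_filter /pos subr_ge0 => /andP[].
have exit n h h0 x : all (fun z => height z < a + L) h ->
    all (fun z => height z < a) h0 -> a + L <= height x <= a + L + 1 ->
    history_bound n (h ++ h0) x <= history_weight h0 * q *
      slab_bound pos [seq z <- h | a <= height z] x.
  move=> hL h0a xout; apply: (le_trans (next _ _ _ _ xout)).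
    rewrite all_cat hL; apply: sub_all h0a => z /= za; have := L_ge1; lra.
  rewrite -mulrA [q * _]mulrC mulrA; apply: ler_wpM2r => //.
  apply: (@le_trans _ _ (history_weight h0 *
      history_weight [seq z <- h | a <= height z])).
    rewrite /history_weight -expRD ler_expR -mulrDr ler_wnM2l ?oppr_le0 //.
    rewrite -natrD ler_nat addnC; apply: truncated_cost_cat.
    by apply: sub_all h0a => z /=; rewrite ltNge.
  apply: ler_wpM2l => //; apply: slab_bound_exit => //.
  by rewrite /pos; move/andP: xout => [? ?]; apply/andP; split; lra.
elim=> [|n IH] h h0 x hL h0a xL.
  have [xout|xin] := leP (a + L) (height x); first by apply: exit => //; rewrite xout.
  have xy : (x == y) = false by apply/eqP => xy; move: xin; rewrite xy; lra.
  rewrite /= xy mulr_ge0 ?mulr_ge0 // slab_bound_ge0 // /pos; lra.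
have [xout|xin] := leP (a + L) (height x); first by apply: exit => //; rewrite xout.
have xy : (x == y) = false by apply/eqP => xy; move: xin; rewrite xy; lra.
rewrite [history_bound _ _ _]/= xy.
have xhL : all (fun z => height z < a + L) (x :: h) by rewrite /= xin.
apply: (@le_trans _ _ (step_avg (fun s => history_weight h0 * q *
    slab_bound pos [seq z <- x :: h | a <= height z] (x + step s)))).
  apply: step_avg_le => s; apply: (IH (x :: h)) => //.
  by rewrite height_step; have := rise_bound e_unit s; lra.
rewrite step_avgZ; apply: ler_wpM2l; first exact: mulr_ge0.
rewrite /=; case: ifPn => ax.
  by apply: (slab_bound_step d_gt0 e_unit) => //; rewrite /pos subr_ge0.
by apply: (slab_bound_step_low d_gt0 e_unit) => //; rewrite /pos subr_lt0 ltNge.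
Qed.

(** At each first passage the record restarts empty and the whole past moves to [h0]; the window of
    length 1 for the height of [x] is the overshoot. *)
Lemma history_bound_iter (j : nat) (a : R) : a + j%:R * L <= height y ->
  forall n h x, all (fun z => height z < a) h -> a <= height x <= a + 1 ->
    history_bound n h x <= history_weight h * slab_factor ^+ j.
Proof.
elim: j a => [|j IH] a ay n h x ha xa.
  by rewrite expr0 mulr1; exact: history_bound_le.
have aLy : a + L <= height y.
  apply: le_trans ay; rewrite lerD2l -{1}[L]mul1r; apply: ler_wpM2r.
    by have := L_ge1; lra.
  by rewrite ler1n.
have next : forall n h x, all (fun z => height z < a + L) h ->
    a + L <= height x <= a + L + 1 -> history_bound n h x <= history_weight h * slab_factor ^+ j.
  by apply: IH; rewrite -addrA -{1}[L]mul1r -mulrDl nat1r.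
have := history_bound_slab (exprn_ge0 j slab_factor_ge0) aLy next n (h := [::]).
move=> /(_ h x isT ha) /= h1.
apply: le_trans (h1 _) _; first by have := L_ge1; move/andP: xa; lra.
rewrite exprSr mulrA; apply: ler_wpM2l.
  by rewrite mulr_ge0 ?expR_ge0 ?exprn_ge0 // slab_factor_ge0.
rewrite /slab_bound big_nil mulr0 expR0 mul1r addr0 /slab_factor decay_low; last first.
  by move/andP: xa; lra.
rewrite lerD2l; apply: ler_wpM2l; last exact: budget_le.
by rewrite site_fee_ge0.
Qed.

Lemma history_bound_origin (j n : nat) : j%:R * L <= height y ->
  history_bound n [::] 0 <= slab_factor ^+ j.
Proof.
move=> jy; have := @history_bound_iter j 0 _ n [::] 0 isT.
rewrite height0 !add0r lexx ler01 => /(_ jy isT) /le_trans; apply.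
by rewrite /history_weight mulr0 expR0 mul1r.
Qed.

End history.

(** * Product formula for independent sites *)

Section independence.
Variables (dO : measure_display) (Omega : measurableType dO) (R : realType).
Variables (P : probability Omega R) (I : choiceType) (U : I -> Omega -> R).
Hypothesis mU : forall i, measurable_fun setT (U i).
Hypothesis indep : mutually_independent P measurable U.

Let measurable_indic_U i (B : set R) : measurable B ->
  measurable_fun setT (fun w => \1_B (U i w) : R).
Proof. by move=> mB; apply: measurableT_comp => //; exact: measurable_indic. Qed.

Lemma independent_expectation_indic (t : seq I) (B : I -> set R) : uniq t ->
  (forall i, measurable (B i)) ->
  ('E_P[fun w => (\prod_(i <- t) \1_(B i) (U i w))%R] =
   \prod_(i <- t) P (U i @^-1` B i))%E.
Proof.
move=> ut mB; rewrite -(independent_seq indep ut (fun i _ => mB i)).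
have mA : measurable (\bigcap_(i in [set` t]) (U i @^-1` B i)).
  apply: fin_bigcap_measurable => [|i _]; first exact: finite_seq.
  by rewrite -[X in measurable X]setTI; exact: mU.
rewrite -(expectation_indic P mA); congr (expectation P _); apply/funext => w.
rewrite indicE; case: (boolP (w \in _)); rewrite ?notin_setE ?inE => h.
  rewrite big_seq big1 // => i it; rewrite indicE mem_set //; exact: h.
have /existsNP[i /not_implyP[it nB]] : ~ forall i, [set` t] i -> (U i @^-1` B i) w by [].
by rewrite (big_rem i) //= indicE memNset ?mul0r.
Qed.

Variables (T : finType) (kc : R -> T).
Hypothesis mkc : forall j, measurable (kc @^-1` [set j]).

Lemma measurable_class i (f : T -> R) : measurable_fun setT (fun w => f (kc (U i w))).
Proof.
rewrite (_ : (fun w => _) = (fun w => \sum_j f j * \1_(kc @^-1` [set j]) (U i w))).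
  by apply: measurable_sum => j; apply: measurable_funM => //; exact: measurable_indic_U.
apply/funext => w; rewrite (bigD1 (kc (U i w))) //= indicE mem_set // mulr1.
rewrite big1 ?addr0 // => j ne; rewrite indicE memNset ?mulr0 //= => e.
by rewrite e eqxx in ne.
Qed.

Lemma class_expectation i (f : T -> R) : (forall j, 0 <= f j) ->
  ('E_P[fun w => f (kc (U i w))] = \sum_j (f j)%:E * P (U i @^-1` (kc @^-1` [set j])))%E.
Proof.
move=> f0.
have -> : (fun w => f (kc (U i w))) = (fun w => \sum_j f j * \1_(kc @^-1` [set j]) (U i w)).
  apply/funext => w; rewrite (bigD1 (kc (U i w))) //= indicE mem_set // mulr1.
  rewrite big1 ?addr0 // => j ne; rewrite indicE memNset ?mulr0 //= => e.
  by rewrite e eqxx in ne.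
rewrite ge0_expectation_sum => [|j|j w]; last by rewrite mulr_ge0.
  apply: eq_bigr => j _; rewrite ge0_expectationZl //; last exact: measurable_indic_U.
  have := @independent_expectation_indic [:: i] (fun=> kc @^-1` [set j]) isT (fun=> mkc j).
  rewrite big_seq1 => <-; congr (_ * _)%E; congr (expectation P _).
  by apply/funext => w; rewrite big_seq1.
by apply: measurable_funM => //; exact: measurable_indic_U.
Qed.

(** Independence is known for events only. The induction expands one factor at a time over the
    finitely many classes and moves it, as an indicator, from [s] to [t]. *)
Let mixed_expectation (s t : seq I) (F : I -> T -> R) (B : I -> set R) :
  uniq (s ++ t) -> (forall i j, 0 <= F i j) -> (forall i, measurable (B i)) ->
  ('E_P[fun w => (\prod_(i <- s) F i (kc (U i w)) * \prod_(i <- t) \1_(B i) (U i w))%R] =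
   \prod_(i <- s) 'E_P[fun w => F i (kc (U i w))] * \prod_(i <- t) P (U i @^-1` B i))%E.
Proof.
move=> + F0; elim: s t B => [|i s IH] t B ust mB.
  rewrite big_nil mul1e -independent_expectation_indic //.
  by congr (expectation P _); apply/funext => w; rewrite big_nil mul1r.
pose Bj j z := if z == i then kc @^-1` [set j] else B z.
have mBj j z : measurable (Bj j z) by rewrite /Bj; case: ifP.
have it : i \notin t by move: ust; rewrite cat_cons cons_uniq mem_cat negb_or => /andP[/andP[]].
have ust' : uniq (s ++ i :: t).
  by rewrite -cat_rcons (perm_uniq (_ : perm_eq _ ((i :: s) ++ t))) // perm_cat2r perm_rcons.
have indt j w : \prod_(z <- i :: t) \1_(Bj j z) (U z w) =
    \1_(kc @^-1` [set j]) (U i w) * \prod_(z <- t) \1_(B z) (U z w) :> R.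
  rewrite big_cons /Bj eqxx; congr (_ * _); rewrite !big_seq; apply: eq_bigr => z zt.
  by case: eqP => // zi; rewrite -zi zt in it.
have Pt j : (\prod_(z <- i :: t) P (U z @^-1` Bj j z) =
    P (U i @^-1` (kc @^-1` [set j])) * \prod_(z <- t) P (U z @^-1` B z))%E.
  rewrite big_cons /Bj eqxx; congr (_ * _)%E; rewrite !big_seq; apply: eq_bigr => z zt.
  by case: eqP => // zi; rewrite -zi zt in it.
transitivity ('E_P[fun w => (\sum_j F i j * (\prod_(z <- s) F z (kc (U z w)) *
     \prod_(z <- i :: t) \1_(Bj j z) (U z w)))%R])%E.
  congr (expectation P _); apply/funext => w; rewrite big_cons.
  rewrite (bigD1 (kc (U i w))) //= indt indicE mem_set // mul1r.
  rewrite [X in _ + X]big1 ?addr0 ?mulrA // => j ne; rewrite indt indicE memNset ?mul0r ?mulr0 //= => e.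
  by rewrite e eqxx in ne.
have prod0 j w : 0 <= \prod_(z <- s) F z (kc (U z w)) *
     \prod_(z <- i :: t) \1_(Bj j z) (U z w).
  by rewrite mulr_ge0 // prodr_ge0.
have mprod j : measurable_fun setT (fun w => \prod_(z <- s) F z (kc (U z w)) *
     \prod_(z <- i :: t) \1_(Bj j z) (U z w)).
  apply: measurable_funM; apply: measurable_prod => z _; first exact: measurable_class.
  exact: measurable_indic_U.
rewrite ge0_expectation_sum => [|j|j w]; last by rewrite mulr_ge0.
  rewrite big_cons class_expectation // -muleA.
  rewrite ge0_sume_distrl; last by move=> j _; rewrite mule_ge0 ?lee_fin.
  apply: eq_bigr => j _; rewrite ge0_expectationZl // IH // Pt.
  by rewrite -muleA; congr (_ * _)%E; rewrite muleCA.
exact: measurable_funM.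
Qed.

Lemma independent_expectation_prod (s : seq I) (F : I -> T -> R) :
  uniq s -> (forall i j, 0 <= F i j) ->
  ('E_P[fun w => (\prod_(i <- s) F i (kc (U i w)))%R] =
   \prod_(i <- s) 'E_P[fun w => F i (kc (U i w))])%E.
Proof.
move=> us F0; have := @mixed_expectation s [::] F (fun=> setT).
rewrite cats0 big_nil mule1 => <- //.
by congr (expectation P _); apply/funext => w; rewrite big_nil mulr1.
Qed.

End independence.

(** * Annealed survival weight *)

Section annealed_weight.
Variables (dO : measure_display) (Omega : measurableType dO) (R : realType).
Variables (P : probability Omega R) (d : nat) (U : 'rV[int]_d -> Omega -> R).
Hypothesis mU : forall x, measurable_fun setT (U x).
Hypothesis U_ge0 : forall x w, 0 <= U x w.
Hypothesis indep : mutually_independent P measurable U.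
Variables (T : finType) (kc : R -> T) (val : T -> R) (b m delta : R) (N : nat).
Hypothesis mkc : forall j, measurable (kc @^-1` [set j]).
Hypothesis val_bound : forall j, 0 <= val j <= b.
Hypothesis val_le : forall u, 0 <= u -> val (kc u) <= u.
Hypothesis m_le : forall x, (m%:E <= 'E_P[fun w => val (kc (U x w))])%E.
Hypothesis delta_bound : N%:R * b <= delta <= 1.
Hypothesis d_gt0 : (0 < d)%N.
Hypothesis m_ge0 : 0 <= m.

Let lam := (1 - delta) * m.

Let mclass x (f : T -> R) : measurable_fun setT (fun w => f (kc (U x w))).
Proof. exact: (measurable_class mU mkc). Qed.

(** With t = c val <= delta one has exp(-t) <= 1/(1 + t) <= 1 - t + t^2 <= 1 - (1 - delta) t. Taking
    means and using 1 - s <= exp(-s) gives the rate [lam] per visit. *)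
Let single_site_weight x c : (c <= N)%N ->
  ('E_P[fun w => expR (- (c%:R * val (kc (U x w))))] <= (expR (- lam * c%:R))%:E)%E.
Proof.
move=> cN; have /andP[Nb d1] := delta_bound.
have t_bound j : 0 <= c%:R * val j <= delta.
  have /andP[v0 vb] := val_bound j; apply/andP; split; first exact: mulr_ge0.
  by apply: le_trans Nb; apply: ler_pM; rewrite ?ler_nat.
have k0 : 0 <= (1 - delta) * c%:R by rewrite mulr_ge0 // subr_ge0.
have : ('E_P[fun w => (expR (- (c%:R * val (kc (U x w)))) +
    (1 - delta) * c%:R * val (kc (U x w)))%R] <= 'E_P[cst 1%R])%E.
  apply: ge0_expectation_le => //.
  - exact: (mclass x (fun j => expR (- (c%:R * val j)) + (1 - delta) * c%:R * val j)).
  - move=> w; rewrite addr_ge0 ?expR_ge0 // mulr_ge0 //.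
    by case/andP: (val_bound (kc (U x w))).
  - move=> w /=; have := t_bound (kc (U x w)); rewrite -mulrA.
    set t := c%:R * _ => /andP[t0 td].
    have : expR (- t) <= (1 + t)^-1.
      by rewrite expRN lef_pV2 ?posrE ?expR_gt0 ?expR_ge1Dx //; lra.
    have : (1 + t)^-1 <= 1 - t + t ^+ 2.
      by rewrite -[leLHS]mul1r ler_pdivrMr; [nra|lra].
    have : t ^+ 2 <= delta * t by rewrite expr2 ler_wpM2r.
    lra.
have mval : measurable_fun setT (fun w => val (kc (U x w))) by exact: mclass.
have val0 w : 0 <= val (kc (U x w)) by case/andP: (val_bound (kc (U x w))).
rewrite expectation_cst ge0_expectationD //; last 3 first.
- exact: (mclass x (fun j => expR (- (c%:R * val j)))).
- exact: measurable_funM.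
- by move=> w; rewrite mulr_ge0.
rewrite ge0_expectationZl //.
move=> le1; have : ('E_P[fun w => expR (- (c%:R * val (kc (U x w))))] +
    ((1 - delta) * c%:R * m)%:E <= 1%:E)%E.
  by apply: le_trans le1; rewrite EFinM leeD2l // lee_wpmul2l.
rewrite -leeBrDr // -EFinB => /le_trans; apply; rewrite lee_fin.
apply: le_trans (expR_ge1Dx _); rewrite /lam le_eqVlt; apply/orP; left; apply/eqP; ring.
Qed.

Let sum_history_ge h w :
  \sum_(x <- undup h) (minn (count_mem x h) N)%:R * val (kc (U x w)) <=
  \sum_(x <- h) U x w.
Proof.
rewrite -[leRHS]big_undup_iterop_count; apply: ler_sum => x _.
rewrite -[iterop _ _ _ _]/(U x w *+ count_mem x h) -[leRHS]mulr_natl.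
have /andP[v0 _] := val_bound (kc (U x w)).
by apply: ler_pM => //; [rewrite ler_nat geq_minl|exact: val_le].
Qed.

Lemma measurable_history_sum h : measurable_fun setT (fun w => expR (- \sum_(x <- h) U x w)).
Proof. by do 2 apply: measurableT_comp => //; exact: measurable_sum. Qed.

Lemma annealed_history_weight h :
  ('E_P[fun w => expR (- \sum_(x <- h) U x w)] <= (history_weight lam N h)%:E)%E.
Proof.
pose F x j := expR (- ((minn (count_mem x h) N)%:R * val j)).
have F0 x j : 0 <= F x j by exact: expR_ge0.
apply: (@le_trans _ _ ('E_P[fun w => (\prod_(x <- undup h) F x (kc (U x w)))%R])%E).
  apply: ge0_expectation_le => //.
  - exact: measurable_history_sum.
  - by apply: measurable_prod => x _; exact: mclass.
  - by move=> w; rewrite /F -expR_sum sumrN ler_expR lerN2.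
rewrite (independent_expectation_prod mU indep mkc) ?undup_uniq //.
rewrite /history_weight truncated_cost_sum natr_sum mulr_sumr expR_sum -prodEFin.
have E0 x : (0 <= 'E_P[fun w => F x (kc (U x w))])%E by exact: expectation_ge0.
elim: (undup h) => [|x s IH]; first by rewrite !big_nil.
rewrite !big_cons; apply: lee_pmul => //; first by rewrite prode_ge0.
by apply: single_site_weight; exact: geq_minr.
Qed.

Variable y : 'rV[int]_d.

(** Visits to the same site are dependent, so the past stays inside the expectation; the environment
    is averaged out only once the path has ended. *)
Lemma annealed_history_bound n h x :
  ('E_P[fun w => (expR (- \sum_(z <- h) U z w) * walk_survival (U ^~ w) y n x)%R] <=
   (history_bound lam N y n h x)%:E)%E.
Proof.
elim: n h x => [|n IH] h x /=; have [xy|xy] := eqVneq x y.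
- by under [X in expectation _ X]eq_fun do rewrite mulr1; exact: annealed_history_weight.
- by under [X in expectation _ X]eq_fun do rewrite mulr0; rewrite expectation_cst.
- by under [X in expectation _ X]eq_fun do rewrite mulr1; exact: annealed_history_weight.
pose G s w := expR (- \sum_(z <- x :: h) U z w) * walk_survival (U ^~ w) y n (x + step s).
have G0 s w : 0 <= G s w by rewrite mulr_ge0 ?expR_ge0 ?walk_survival_ge0.
have mG s : measurable_fun setT (G s).
  by apply: measurable_funM; [exact: measurable_history_sum|exact: measurable_walk_survival].
rewrite [X in expectation _ X](_ : _ = (fun w => (2 * d)%N%:R^-1 * \sum_s G s w)); last first.
  apply/funext => w; rewrite /G -mulr_sumr big_cons opprD expRD; ring.
rewrite ge0_expectationZl //; last 2 first.
- exact: measurable_sum.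
- by move=> w; rewrite sumr_ge0.
rewrite ge0_expectation_sum // /step_avg EFinM -sumEFin lee_pmul2l ?lte_fin //.
  by apply: lee_sum => s _; exact: IH.
by rewrite invr_gt0 ltr0n muln_gt0.
Qed.

Variables (dW : measure_display) (W : measurableType dW) (Q : probability W R).
Variable (S : nat -> W -> 'rV[int]_d).
Hypothesis hS : simple_random_walk Q S.
Variables (e : 'I_d -> R) (kap L theta : R).
Hypothesis e_unit : \sum_i e i ^+ 2 = 1.
Hypothesis kap_ge0 : 0 <= kap.
Hypothesis kapE : kap ^+ 2 * (1 + d%:R * lam) = 2 * d%:R * lam.
Hypothesis L_ge1 : 1 <= L.
Hypothesis factor_le : slab_factor d N kap L <= expR (- theta).

Let lam_ge0 : 0 <= lam.
Proof. by rewrite mulr_ge0 // subr_ge0; case/andP: delta_bound. Qed.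

Lemma annealed_survival_le (j : nat) : j%:R * L <= height e y ->
  ('E_P[fun w => survival Q S (U ^~ w) y] <= (expR (- theta * j%:R))%:E)%E.
Proof.
move=> jy.
have cvgE : ('E_P[fun w => walk_survival (U ^~ w) y n 0] @[n --> \oo] -->
    'E_P[fun w => survival Q S (U ^~ w) y])%E.
  rewrite unlock.
  have -> : (\int[P]_w (survival Q S (U ^~ w) y)%:E =
      \int[P]_w limn (fun n => (walk_survival (U ^~ w) y n 0)%:E))%E.
    apply: eq_integral => w _; apply/esym/cvg_lim => //.
    apply: cvg_EFin; first exact: nearW.
    exact: (walk_survival_cvg d_gt0 hS).
  apply: cvg_monotone_convergence => //.
  - by move=> n; apply/measurable_EFinP; exact: measurable_walk_survival.
  - by move=> n w _; rewrite lee_fin walk_survival_ge0.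
  - by move=> w _ m' n' mn; rewrite lee_fin; exact: walk_survival_le.
apply: (cvge_to_le cvgE); apply: nearW => n.
have := annealed_history_bound n [::] 0.
rewrite [X in expectation _ X](_ : _ = (fun w => walk_survival (U ^~ w) y n 0)); last first.
  by apply/funext => w; rewrite big_nil oppr0 expR0 mul1r.
move=> /le_trans; apply; rewrite lee_fin.
apply: (le_trans (history_bound_origin d_gt0 N lam_ge0 e_unit kap_ge0 kapE L_ge1 n jy)).
rewrite expRM_natr; apply: lerXn2r => //; rewrite nnegrE ?expR_ge0 //.
exact: slab_factor_ge0.
Qed.

End annealed_weight.

(** * Norms and the entropy of a tilted step law *)

(** A homogeneous inequality that holds up to a bounded error is exact; this absorbs the rounding of
    p x to an integer vector. *)
Lemma le_of_natmul_le (R : realType) (a b c : R) : (forall p : nat, (0 < p)%N -> p%:R * a <= p%:R * b + c) -> a <= b.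
Proof.
move=> h; apply/ler_addgt0Pr => e e0.
pose p := (Num.truncn (`|c| / e)).+1.
have p0 : 0 < p%:R :> R by rewrite ltr0n.
rewrite -(ler_pM2l p0); apply: (le_trans (h p isT)).
rewrite mulrDr lerD2l; apply: le_trans (ler_norm _) _.
by rewrite -ler_pdivrMr // ltW // truncnS_gt.
Qed.

Section norm.
Variables (R : realType) (d : nat) (N : 'rV[R]_d -> R).
Hypothesis hN : is_norm N.

Lemma is_norm0 : N 0 = 0.
Proof. by case: hN => _ hZ _; rewrite -(scale0r 0) hZ normr0 mul0r. Qed.

Lemma is_normN x : N (- x) = N x.
Proof. by case: hN => _ hZ _; rewrite -scaleN1r hZ normrN1 mul1r. Qed.

Lemma is_norm_ge0 x : 0 <= N x.
Proof.
case: hN => _ _ hD; have := hD x (- x); rewrite subrr is_norm0 is_normN; lra.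
Qed.

Definition norm_basis_sum : R := \sum_(i < d) N (delta_mx 0 i).

Lemma is_norm_le_coord (x : 'rV[R]_d) (r : R) : (forall i, `|x 0 i| <= r) -> N x <= r * norm_basis_sum.
Proof.
move=> xr; case: hN => _ hZ hD.
rewrite {1}(row_sum_delta x) /norm_basis_sum mulr_sumr.
elim/big_rec2: _ => [|i a b _ ab]; first by rewrite is_norm0.
apply: (le_trans (hD _ _)); apply: lerD => //.
by rewrite hZ; apply: ler_wpM2r; [exact: is_norm_ge0|exact: xr].
Qed.

(** Rounding is towards zero, so that a coordinate divided by p never exceeds that of [x] in
    absolute value; the entropy bound for [x] then also covers its approximations. *)
Definition trunc_vec (p : nat) (x : 'rV[R]_d) : 'rV[int]_d :=
  \row_i (if 0 <= x 0 i then (Num.truncn (p%:R * x 0 i))%:Z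
          else - (Num.truncn (p%:R * - x 0 i))%:Z).

Lemma trunc_vecP (p : nat) (x : 'rV[R]_d) (i : 'I_d) :
  `|p%:R * x 0 i - (trunc_vec p x 0 i)%:~R| <= 1 /\
  `|(trunc_vec p x 0 i)%:~R| <= p%:R * `|x 0 i|.
Proof.
rewrite mxE; set t := x 0 i; have [t0|t0] := lerP 0 t.
  have pt : 0 <= p%:R * t by rewrite mulr_ge0.
  have /andP[h1 h2] := truncn_itv pt; rewrite -natr1 in h2.
  rewrite (ger0_norm t0) (ger0_norm (ler0n _ _)) ger0_norm; first by split; lra.
  by rewrite subr_ge0.
have pt : 0 <= p%:R * - t by rewrite mulr_ge0 // oppr_ge0 ltW.
have /andP[h1 h2] := truncn_itv pt; rewrite -natr1 in h2.
rewrite rmorphN normrN (ger0_norm (ler0n _ _)) (ltr0_norm t0) /=; split => //.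
by rewrite ler_norml; apply/andP; split; lra.
Qed.

Lemma is_norm_trunc_vec (p : nat) (x : 'rV[R]_d) : `|p%:R * N x - N (int_vec R (trunc_vec p x))| <= norm_basis_sum.
Proof.
case: hN => _ hZ hD; set l := int_vec R _.
have -> : p%:R * N x = N (p%:R *: x) by rewrite hZ normr_nat.
have : N (p%:R *: x - l) <= norm_basis_sum.
  rewrite -[norm_basis_sum]mul1r; apply: is_norm_le_coord => i.
  by rewrite !mxE; have [+ _] := trunc_vecP p x i; rewrite mxE.
have := hD (p%:R *: x - l) l; rewrite subrK.
have := hD (l - p%:R *: x) (p%:R *: x); rewrite subrK -opprB is_normN.
by rewrite ler_norml => ? ? ?; apply/andP; split; lra.
Qed.

Lemma is_norm_ge_linear (c : 'I_d -> R) :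
  (forall l : 'rV[int]_d, \sum_i c i * (l 0 i)%:~R <= N (int_vec R l)) ->
  forall x : 'rV[R]_d, \sum_i c i * x 0 i <= N x.
Proof.
move=> h x; apply: (@le_of_natmul_le _ _ _ (\sum_i `|c i| + norm_basis_sum)) => p p0.
have := h (trunc_vec p x); have := is_norm_trunc_vec p x; rewrite ler_norml => /andP[].
have : p%:R * \sum_i c i * x 0 i - \sum_i c i * (trunc_vec p x 0 i)%:~R <= \sum_i `|c i|.
  rewrite mulr_sumr -sumrB; apply: ler_sum => i _; rewrite mulrCA -mulrBr.
  apply: le_trans (ler_norm _) _; rewrite normrM -[leRHS]mulr1; apply: ler_wpM2l => //.
  by have [] := trunc_vecP p x i.
lra.
Qed.

Lemma is_norm_le_of_int (x : 'rV[R]_d) (K : R) :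
  (forall (p : nat) (l : 'rV[int]_d), (0 < p)%N ->
     (forall i, `|(l 0 i)%:~R / p%:R| <= `|x 0 i|) -> N (int_vec R l) <= p%:R * K) ->
  N x <= K.
Proof.
move=> h; apply: (@le_of_natmul_le _ _ _ norm_basis_sum) => p p0.
have p0' : 0 < p%:R :> R by rewrite ltr0n.
have := h p (trunc_vec p x) p0; have := is_norm_trunc_vec p x; rewrite ler_norml => /andP[_ h1] h2.
have : N (int_vec R (trunc_vec p x)) <= p%:R * K.
  apply: h2 => i; rewrite normrM normfV (ger0_norm (ltW p0')) ler_pdivrMr // mulrC.
  by have [] := trunc_vecP p x i.
lra.
Qed.

End norm.

Lemma is_norm_le_of_int_vec (R : realType) (d : nat) (N N' : 'rV[R]_d -> R) :
  is_norm N -> is_norm N' ->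
  (forall l, N (int_vec R l) <= N' (int_vec R l)) -> forall x, N x <= N' x.
Proof.
move=> hN hN' NN' x.
apply: (@le_of_natmul_le _ _ _ (norm_basis_sum N + norm_basis_sum N')) => p _.
have := is_norm_trunc_vec hN p x; have := is_norm_trunc_vec hN' p x.
have := NN' (trunc_vec p x); rewrite !ler_norml => ? /andP[? ?] /andP[? ?]; lra.
Qed.

Lemma norm2_sqr (R : realType) (d : nat) (x : 'rV[R]_d) :
  norm2 x ^+ 2 = \sum_i x 0 i ^+ 2.
Proof. by rewrite sqr_sqrtr // sumr_ge0 // => i _; exact: sqr_ge0. Qed.

Lemma norm2_eq0 (R : realType) (d : nat) (x : 'rV[R]_d) : norm2 x = 0 -> x = 0.
Proof.
move=> x0; apply/rowP => i; rewrite mxE; apply/eqP; rewrite -sqrf_eq0.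
have := norm2_sqr x; rewrite x0 expr0n /= => /esym/eqP.
by rewrite psumr_eq0 => [/allP /(_ i)|j _]; rewrite ?mem_index_enum ?sqr_ge0 //; apply.
Qed.

(** The Euclidean norm is the value of the linear form with unit direction e = x / |x|. Linear lower
    bounds pass from integer to real vectors, even though this [e] depends on [x]. *)
Lemma is_norm_ge_norm2 (R : realType) (d : nat) (N : 'rV[R]_d -> R) (c : R) :
  is_norm N ->
  (forall e : 'I_d -> R, \sum_i e i ^+ 2 = 1 ->
     forall l : 'rV[int]_d, c * height e l <= N (int_vec R l)) ->
  forall x, c * norm2 x <= N x.
Proof.
move=> hN h x; have [x0|x0] := eqVneq (norm2 x) 0.
  by rewrite x0 mulr0 is_norm_ge0.
have := @is_norm_ge_linear _ _ _ hN (fun i => c * (x 0 i / norm2 x)) _ x.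
have -> : \sum_i c * (x 0 i / norm2 x) * x 0 i = c * norm2 x.
  transitivity (c / norm2 x * \sum_i x 0 i ^+ 2).
    by rewrite mulr_sumr; apply: eq_bigr => i _; field.
  by rewrite -norm2_sqr; field.
apply=> l; under eq_bigr do rewrite -mulrA; rewrite -mulr_sumr; apply: h.
under eq_bigr do rewrite exprMn; rewrite -mulr_suml -norm2_sqr -exprMn mulfV //.
exact: expr1n.
Qed.

Section entropy.
Variables (R : realType) (d : nat).
Hypothesis d_gt0 : (0 < d)%N.
Variable v : 'I_d -> R.

(** A linear rather than exponential tilt: its mean is exactly [v], and its entropy has the same
    second-order term. *)
Definition tilted_law (s : 'I_d * bool) : R :=
  (1 + d%:R * (if s.2 then - v s.1 else v s.1)) / (2 * d)%N%:R.

Let d0 : 0 < d%:R :> R. Proof. by rewrite ltr0n. Qed.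

Lemma tilted_law_sum1 : \sum_s tilted_law s = 1.
Proof.
rewrite sum_dir (eq_bigr (fun=> d%:R^-1)) => [|i _].
  by rewrite sumr_const card_ord -[_^-1 *+ d]mulr_natl mulfV ?gt_eqF.
by rewrite /tilted_law /= natrM; field; rewrite gt_eqF.
Qed.

Lemma tilted_law_drift i : drift tilted_law i = v i.
Proof. by rewrite /drift /tilted_law /= natrM; field; rewrite gt_eqF. Qed.

Variables (A : R).
Hypothesis A_lt1 : A < 1.
Hypothesis v_bound : forall i, (d%:R * v i) ^+ 2 <= A.

Let v_norm i : `|d%:R * v i| < 1.
Proof. by have := v_bound i; have := A_lt1; rewrite ltr_norml => ? ?; apply/andP; split; nra. Qed.

Lemma tilted_law_gt0 s : 0 < tilted_law s.
Proof.
rewrite divr_gt0 ?ltr0n ?muln_gt0 //.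
have := v_norm s.1; rewrite ltr_norml => /andP[? ?].
by case: (s.2); lra.
Qed.

(** Each axis contributes [entropy_pair_le] at a = d v_i, divided by 2d, which is d v_i^2 / 2 to
    leading order. *)
Lemma tilted_law_entropy : \sum_s tilted_law s * ln ((2 * d)%N%:R * tilted_law s) <=
  d%:R / 2 * (\sum_i v i ^+ 2) * ((1 + A) / (1 - A)).
Proof.
have D0 : (2 * d)%N%:R != 0 :> R by rewrite pnatr_eq0 muln_eq0 /= -lt0n.
rewrite sum_dir mulr_sumr mulr_suml; apply: ler_sum => i _.
rewrite /tilted_law /= ![(2 * d)%N%:R * (_ / _)]mulrC !divfK //.
set a := d%:R * v i; rewrite mulrN -/a.
have h := entropy_pair_le (v_norm i).
have a2 := v_bound i; rewrite -/a in h a2.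
have a0 := sqr_ge0 a.
have A1 := A_lt1.
have h2 : a ^+ 2 * (1 + a ^+ 2) / (1 - a ^+ 2) <= a ^+ 2 * ((1 + A) / (1 - A)).
  rewrite -mulrA; apply: ler_wpM2l => //.
  rewrite ler_pdivrMr; last by lra.
  rewrite mulrAC ler_pdivlMr; last by lra.
  nra.
rewrite [leLHS](_ : _ = ((1 + a) * ln (1 + a) + (1 - a) * ln (1 - a)) / (2 * d)%N%:R); last first.
  by field; rewrite gt_eqF.
rewrite ler_pdivrMr ?ltr0n ?muln_gt0 //; apply: (le_trans (le_trans h h2)).
by rewrite le_eqVlt natrM; apply/orP; left; apply/eqP; rewrite /a; set r := _ / (1 - A); field.
Qed.

End entropy.

(** * Quenched upper bound *)

Lemma iid_expectation (dO : measure_display) (Omega : measurableType dO)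
    (R : realType) (P : probability Omega R) (d : nat)
    (U : 'rV[int]_d -> {RV P >-> R}) (f : R -> R) : iid_potential U ->
  measurable_fun setT f -> (forall t, 0 <= f t) ->
  forall x, ('E_P[fun w => f (U x w)] = 'E_P[fun w => f (U 0%R w)])%E.
Proof.
case=> _ _ law mf f0 x; rewrite unlock.
have mEf : measurable_fun setT (fun t => (f t)%:E) by exact/measurable_EFinP.
have Ef0 t : (0 <= (f t)%:E)%E by rewrite lee_fin.
rewrite -[LHS](ge0_integral_distribution (U x) mEf Ef0).
rewrite -[RHS](ge0_integral_distribution (U 0) mEf Ef0).
by apply: eq_measure_integral => A mA _; exact: law.
Qed.

Section bounds.
Variables (dO dW : measure_display) (Omega : measurableType dO).
Variables (W : measurableType dW) (R : realType).
Variables (P : probability Omega R) (Q : probability W R).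
Variables (d : nat) (S : nat -> W -> 'rV[int]_d).
Hypothesis d_gt0 : (0 < d)%N.
Hypothesis hS : simple_random_walk Q S.
Variables (U : 'rV[int]_d -> Omega -> R) (mu : R).
Hypothesis mU : forall x, measurable_fun setT (U x).
Hypothesis U_ge0 : forall x w, 0 <= U x w.
Hypothesis EU : forall x, ('E_P[U x] = mu%:E)%E.

Let d0 : 0 < d%:R :> R. Proof. by rewrite ltr0n. Qed.

Let s0 : 'I_d * bool := (Ordinal d_gt0, false).

Lemma quenched_le_sqnorm (a : 'rV[R]_d -> R) (x : 'rV[R]_d) :
  quenched_lyapunov P Q S U a ->
  let A := d%:R ^+ 2 * \sum_i x 0 i ^+ 2 in A < 1 ->
  a x <= mu + d%:R / 2 * (\sum_i x 0 i ^+ 2) * ((1 + A) / (1 - A)).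
Proof.
move=> qa A A1; have [norm_a _ _] := qa.
have A0 : 0 <= A by rewrite mulr_ge0 ?sqr_ge0 // sumr_ge0 // => i _; exact: sqr_ge0.
have r0 : 0 <= (1 + A) / (1 - A) by apply: divr_ge0; lra.
apply: (is_norm_le_of_int norm_a) => p l p0 lx.
pose v i : R := (l 0 i)%:~R / p%:R.
have vx i : v i ^+ 2 <= x 0 i ^+ 2.
  by rewrite -[v i ^+ 2]real_normK ?num_real // -[x 0 i ^+ 2]real_normK ?num_real // ler_sqr ?nnegrE ?lx.
have vA i : (d%:R * v i) ^+ 2 <= A.
  rewrite exprMn /A ler_pM2l ?exprn_gt0 // (bigD1 i) //= ler_wpDr //.
  by rewrite sumr_ge0 // => j _; exact: sqr_ge0.
apply: (quenched_le_entropy s0 hS mU U_ge0 EU (q := tilted_law v)) => //.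
- by move=> s; exact: (tilted_law_gt0 d_gt0 A1 vA).
- exact: tilted_law_sum1.
- apply: mulr_ge0 => //; apply: mulr_ge0; first by rewrite divr_ge0.
  by rewrite sumr_ge0 // => i _; exact: sqr_ge0.
- apply: (le_trans (tilted_law_entropy d_gt0 A1 vA)).
  apply: ler_wpM2r => //; rewrite ler_pM2l ?divr_gt0 //.
  by apply: ler_sum => i _; exact: vx.
- by move=> i; rewrite tilted_law_drift // /v mulrCA mulfV ?mulr1 // gt_eqF ?ltr0n.
Qed.

Lemma quenched_le_norm2 (a : 'rV[R]_d -> R) : quenched_lyapunov P Q S U a ->
  0 < mu -> 2 * d%:R * mu < 1 ->
  forall x, a x <= Num.sqrt (2 * d%:R * mu) / (1 - 2 * d%:R * mu) * norm2 x.
Proof.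
move=> qa mu0 mu1 x; have [norm_a _ _] := qa; have [_ aZ _] := norm_a.
have [x0|x0] := eqVneq (norm2 x) 0.
  by rewrite x0 mulr0 (norm2_eq0 x0) is_norm0.
have xpos : 0 < norm2 x by rewrite lt_def x0 sqrtr_ge0.
set A := 2 * d%:R * mu.
have A0 : 0 < A by rewrite !mulr_gt0.
have sA0 : 0 < Num.sqrt A by rewrite sqrtr_gt0.
have sA2 : Num.sqrt A ^+ 2 = A by rewrite sqr_sqrtr // ltW.
(* The length r of [s *: x] is sqrt(2 mu / d), the minimiser of (mu + d r^2 / 2) / r; it makes the
   quantity d^2 r^2 equal to [A]. *)
pose s := Num.sqrt A / (d%:R * norm2 x).
have s0' : 0 < s by rewrite divr_gt0 // mulr_gt0.
have sx2 : \sum_i (s *: x) 0 i ^+ 2 = A / d%:R ^+ 2.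
  under eq_bigr do rewrite mxE exprMn.
  rewrite -mulr_sumr -norm2_sqr /s !exprMn exprVn exprMn sA2.
  by field; rewrite x0 gt_eqF.
have := quenched_le_sqnorm (x := s *: x) qa.
rewrite /= sx2 mulrCA mulfV ?mulr1; last by rewrite gt_eqF ?exprn_gt0.
move=> /(_ mu1); rewrite aZ gtr0_norm // mulrC -ler_pdivlMr // => /le_trans; apply.
rewrite le_eqVlt; apply/orP; left; apply/eqP.
(* The identity is stated with r for sqrt(A), so that it becomes rational and [field] applies. *)
have key (r n D : R) : r != 0 -> n != 0 -> D != 0 -> 1 - r ^+ 2 != 0 ->
    (r ^+ 2 / (2 * D) + D / 2 * (r ^+ 2 / D ^+ 2) * ((1 + r ^+ 2) / (1 - r ^+ 2))) /
    (r / (D * n)) = r / (1 - r ^+ 2) * n.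
  by move=> r0 n0 D0 r1; field; rewrite r0 n0 D0 r1.
have := key (Num.sqrt A) _ _ (lt0r_neq0 sA0) x0 (lt0r_neq0 d0).
rewrite sA2 subr_eq0 eq_sym lt_eqF // => <- //.
congr ((_ + _) / _); rewrite /A; field; rewrite gt_eqF //.
Qed.

End bounds.

(** * Annealed lower bound at fixed intensity *)

Section annealed_lower_bound.
Variables (dO dW : measure_display) (Omega : measurableType dO).
Variables (W : measurableType dW) (R : realType).
Variables (P : probability Omega R) (Q : probability W R).
Variables (d : nat) (S : nat -> W -> 'rV[int]_d) (U : 'rV[int]_d -> {RV P >-> R}).
Hypothesis d_gt0 : (0 < d)%N.
Hypothesis hS : simple_random_walk Q S.
Hypothesis hU : iid_potential U.
Variable mu : R.
Hypothesis EU : ('E_P[U 0%R] = mu%:E)%E.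

Let U_ge0 x w : 0 <= U x w. Proof. by case: hU. Qed.

Let mU x : measurable_fun setT (U x). Proof. exact: measurable_funPT. Qed.

Lemma iid_mean x : ('E_P[U x] = mu%:E)%E.
Proof.
have mpos : measurable_fun setT (fun t : R => Num.max t 0) by exact: measurable_maxr.
have := iid_expectation hU mpos (fun t => _) x.
have E z : (fun w => Num.max (U z w) 0) = U z by apply/funext => w; rewrite max_l.
by rewrite !E EU; apply => t; rewrite le_max lexx orbT.
Qed.

Section discretization.
Variables (g m' : R) (M r : nat).
Hypothesis g_gt0 : 0 < g.
Hypothesis r_gt0 : (0 < r)%N.
Hypothesis m'_ge0 : 0 <= m'.
Hypothesis mean_ge :
  ((m' + r%:R^-1)%:E <= 'E_P[fun w => (Num.min (U 0 w / g) M%:R)%R])%E.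

Definition level (u : R) : 'I_(M * r).+1 := inord (minn (Num.truncn (r%:R * (u / g))) (M * r)).

Definition level_value (j : 'I_(M * r).+1) : R := g * (j%:R / r%:R).

Let r0 : 0 < r%:R :> R. Proof. by rewrite ltr0n. Qed.

Let level_val u : level u = minn (Num.truncn (r%:R * (u / g))) (M * r) :> nat.
Proof. by rewrite /level inordK // ltnS geq_minr. Qed.

Let level_homo u v : u <= v -> (level u <= level v)%N.
Proof.
move=> uv; rewrite !level_val leq_min geq_minr andbT geq_min; apply/orP; left.
by apply: le_truncn; rewrite ler_pM2l // ler_pM2r ?invr_gt0.
Qed.

(** [level] is monotone, so its fibres are intervals. *)
Lemma measurable_level j : measurable (level @^-1` [set j]).
Proof.
apply: is_interval_measurable => u v /= lu lv w /andP[uw wv].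
apply/val_inj/eqP; rewrite eqn_leq -{1}lv -{1}lu /=.
by rewrite !level_homo.
Qed.

Lemma level_value_bound j : 0 <= level_value j <= g * M%:R.
Proof.
apply/andP; split; first by rewrite mulr_ge0 ?divr_ge0 // ltW.
rewrite ler_pM2l // ler_pdivrMr // -natrM ler_nat -ltnS; exact: ltn_ord.
Qed.

Lemma level_value_le u : 0 <= u -> level_value (level u) <= u.
Proof.
move=> u0; rewrite /level_value -ler_pdivlMl // ler_pdivrMr // level_val.
apply: (@le_trans _ _ (Num.truncn (r%:R * (u / g)))%:R); first by rewrite ler_nat geq_minl.
have ug : 0 <= r%:R * (u / g) by rewrite mulr_ge0 // divr_ge0 // ltW.
have /andP[h _] := truncn_itv ug; apply: (le_trans h).
by rewrite [leRHS](_ : _ = r%:R * (u / g)) //; ring.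
Qed.

Lemma level_value_ge u : 0 <= u ->
  g * Num.min (u / g) M%:R <= level_value (level u) + g / r%:R.
Proof.
move=> u0; have -> : level_value (level u) + g / r%:R = g * (((level u)%:R + 1) / r%:R).
  by rewrite /level_value; ring.
rewrite ler_pM2l // ler_pdivlMr // level_val.
have ug : 0 <= r%:R * (u / g) by rewrite mulr_ge0 // divr_ge0 // ltW.
have /andP[_ h] := truncn_itv ug; rewrite -natr1 in h.
case: (leqP (Num.truncn (r%:R * (u / g))) (M * r)) => hm.
  apply: (@le_trans _ _ (u / g * r%:R)); first by rewrite ler_pM2r // ge_min lexx.
  by rewrite mulrC ltW.
apply: (@le_trans _ _ (M%:R * r%:R)); first by rewrite ler_pM2r // ge_min lexx orbT.
by rewrite natrM lerDl.
Qed.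

Lemma level_mean x : ((g * m')%:E <= 'E_P[fun w => level_value (level (U x w))])%E.
Proof.
have g0 := ltW g_gt0.
have ml z : measurable_fun setT (fun w => level_value (level (U z w))).
  exact: (measurable_class mU measurable_level).
have mlR : measurable_fun setT (fun u : R => level_value (level u)).
  (* One variable indexed by [unit]: the identity of the real line in place of the potential. *)
  by apply: (@measurable_class _ R _ unit (fun=> id) _ _ level measurable_level tt).
have l0 u : 0 <= level_value (level u) by case/andP: (level_value_bound (level u)).
have min0 w : 0 <= Num.min (U 0 w / g) M%:R by rewrite le_min divr_ge0 ?U_ge0 ?ler0n.
rewrite (iid_expectation hU mlR l0 x).
have : ('E_P[fun w => (g * Num.min (U 0 w / g) M%:R)%R] <=
    'E_P[fun w => (level_value (level (U 0 w)) + g / r%:R)%R])%E.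
  apply: ge0_expectation_le.
  - apply: measurable_funM => //; apply: measurable_minr => //.
    exact: measurable_funM.
  - by apply: measurable_funD.
  - by move=> w; rewrite mulr_ge0.
  - by move=> w; exact: level_value_ge.
rewrite ge0_expectationZl //; last by apply: measurable_minr => //; exact: measurable_funM.
rewrite ge0_expectationD //; last by move=> _; rewrite divr_ge0.
rewrite expectation_cst => h.
have : (g%:E * (m' + r%:R^-1)%:E <= g%:E * 'E_P[fun w => (Num.min (U 0 w / g) M%:R)%R])%E.
  by apply: lee_wpmul2l => //; rewrite lee_fin ltW.
move=> /le_trans /(_ h); rewrite -EFinM mulrDr EFinD.
by rewrite leeD2rE.
Qed.

End discretization.

Variables (kap L theta g m' delta : R) (N M r : nat).
Hypothesis g_gt0 : 0 < g.
Hypothesis r_gt0 : (0 < r)%N.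
Hypothesis m'_ge0 : 0 <= m'.
Hypothesis mean_ge :
  ((m' + r%:R^-1)%:E <= 'E_P[fun w => (Num.min (U 0 w / g) M%:R)%R])%E.
Hypothesis delta_bound : N%:R * (g * M%:R) <= delta <= 1.
Hypothesis kap_ge0 : 0 <= kap.
Let lam := (1 - delta) * (g * m').
Hypothesis kapE : kap ^+ 2 * (1 + d%:R * lam) = 2 * d%:R * lam.
Hypothesis L_ge1 : 1 <= L.
Hypothesis factor_le : slab_factor d N kap L <= expR (- theta).
Hypothesis theta_ge0 : 0 <= theta.

Variable (b : 'rV[R]_d -> R).
Hypothesis hb : annealed_lyapunov P Q S (fun x => U x : Omega -> R) b.

(** Up to height k e.l there are [j] full slabs, each contributing theta. Rounding [j] down loses at
    most theta, which is at most k eps for large k. *)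
Lemma annealed_ge_height (e : 'I_d -> R) (l : 'rV[int]_d) : \sum_i e i ^+ 2 = 1 ->
  theta / L * height e l <= b (int_vec R l).
Proof.
move=> e1; have [norm_b cvg_b] := hb.
have L0 : 0 < L by apply: lt_le_trans L_ge1.
have [h0|h0] := lerP (height e l) 0.
  apply: le_trans (is_norm_ge0 norm_b _).
  by rewrite mulr_ge0_le0 // divr_ge0 // ltW.
apply/ler_addgt0Pr => eps eps0; rewrite -lerBlDr; apply: (cvgr_to_ge (cvg_b l)).
exists (Num.truncn (theta / eps)).+1 => // k /= kt.
have k0 : 0 < k%:R :> R by rewrite ltr0n; exact: leq_ltn_trans kt.
pose j := Num.truncn (k%:R * height e l / L).
have x0 : 0 <= k%:R * height e l / L by rewrite divr_ge0 ?mulr_ge0 // ltW.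
have /andP[j1 j2] := truncn_itv x0; rewrite -/j -natr1 in j1 j2.
have hk : height e (l *+ k) = k%:R * height e l.
  rewrite /height mulr_sumr; apply: eq_bigr => i _.
  by rewrite mulmxnE rmorphMn /= -mulr_natl; ring.
have jL : j%:R * L <= height e (l *+ k) by rewrite hk -ler_pdivlMr.
have [_ indep _] := hU.
have E1 : ('E_P[fun w => survival Q S (fun x => U x w) (l *+ k)] <= (expR (- theta * j%:R))%:E)%E.
  apply: (@annealed_survival_le _ _ _ _ _ _ mU U_ge0 indep _ (level g M r)
    (@level_value g M r) (g * M%:R) (g * m') delta N _ _ _ _ delta_bound d_gt0
    _ _ _ _ _ _ hS e kap L theta e1 kap_ge0 kapE L_ge1 factor_le j jL).
  - exact: measurable_level.
  - exact: level_value_bound.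
  - exact: level_value_le.
  - exact: level_mean.
  - by rewrite mulr_ge0 // ltW.
have E2 := fine_expectation_survival_ge (Ordinal d_gt0, false) hS mU U_ge0 iid_mean (l *+ k).
have Efin := expectation_survival_fin P (Ordinal d_gt0, false) hS mU U_ge0 (l *+ k).
have E3 : fine 'E_P[fun w => survival Q S (fun x => U x w) (l *+ k)] <= expR (- theta * j%:R).
  by rewrite -lee_fin (fineK Efin).
move: E3 E2; set E := fine _ => E3 E2.
have E0 : 0 < E by exact: lt_le_trans (expR_gt0 _) E2.
have lnE : theta * j%:R <= - ln E.
  by rewrite lerNr -mulNr -[leRHS]expRK ler_ln ?posrE ?expR_gt0.
rewrite mulNr -mulrN ler_pdivlMl //; apply: le_trans lnE.
apply: (@le_trans _ _ (theta * (k%:R * height e l / L) - theta)).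
  rewrite mulrBr; apply: lerB; first by rewrite le_eqVlt; apply/orP; left; apply/eqP; ring.
  rewrite mulrC -ler_pdivrMl // mulrC ltW // (lt_le_trans (truncnS_gt _)) // ler_nat //.
by rewrite -[X in _ - X]mulr1 -mulrBr; apply: ler_wpM2l => //; lra.
Qed.

(** Stated for any norm above [b] on integer vectors, so that it serves both exponents. *)
Lemma annealed_ge_norm2 (a : 'rV[R]_d -> R) : is_norm a ->
  (forall l, b (int_vec R l) <= a (int_vec R l)) ->
  forall x, theta / L * norm2 x <= a x.
Proof.
move=> norm_a ba; apply: is_norm_ge_norm2 => // e e1 l.
exact: le_trans (annealed_ge_height l e1) (ba l).
Qed.

End annealed_lower_bound.

(** * Vanishing intensity *)

Lemma near_mul_le (R : realType) (a b : R) : 0 <= a -> 0 < b ->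
  \forall g \near (0 : R)^'+, a * g <= b.
Proof.
move=> a0 b0; have h : 0 < b / (a + 1) by rewrite divr_gt0 //; lra.
near=> g.
have g0 : 0 < g by near: g; exact: nbhs_right_gt.
have gb : g < b / (a + 1) by near: g; exact: nbhs_right_lt.
by move: gb; rewrite ltr_pdivlMr; nra.
Unshelve. all: by end_near. Qed.

(** At x = D / sqrt(g) the fourth power yields g^2, one factor g more than is needed against a
    budget of order L^2 ~ 1/g. *)
Lemma expRN_le_inv_pow4 (R : realType) (x : R) : 0 < x -> expR (- x) <= 256 / x ^+ 4.
Proof.
move=> x0; have -> : 256 / x ^+ 4 = ((x / 4) ^+ 4)^-1 by field; rewrite gt_eqF.
have p : 0 < x / 4 by lra.
rewrite expRN lef_pV2 ?posrE ?expR_gt0 ?exprn_gt0 //.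
have -> : expR x = expR (x / 4) ^+ 4 by rewrite -expRM_natl; congr expR; field.
apply: lerXn2r; rewrite ?nnegrE ?expR_ge0 ?(ltW p) //.
by apply: le_trans (expR_ge1Dx _); lra.
Qed.

Section asymptotics.
Variables (R : realType) (d : nat) (c m M delta K b1 : R).
Hypothesis d_gt0 : (0 < d)%N.
Hypothesis m_gt0 : 0 < m.
Hypothesis M_gt0 : 0 < M.
Hypothesis delta_gt0 : 0 < delta.
Hypothesis delta_lt1 : delta < 1.
Hypothesis K_gt0 : 0 < K.

Let d0 : 0 < d%:R :> R. Proof. by rewrite ltr0n. Qed.

Definition kill_rate (g : R) : R := (1 - delta) * (g * m).
Definition slope (g : R) : R :=
  Num.sqrt (2 * d%:R * kill_rate g / (1 + d%:R * kill_rate g)).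
Definition slab_width (g : R) : R := K / Num.sqrt g.
Definition saturation (g : R) : nat := Num.truncn (delta / (g * M)).

Let rate_ge0 g : 0 < g -> 0 <= kill_rate g.
Proof. by move=> g0; rewrite /kill_rate !mulr_ge0 ?subr_ge0 // ltW. Qed.

Let denom_gt0 g : 0 < g -> 0 < 1 + d%:R * kill_rate g.
Proof. by move=> g0; rewrite ltr_wpDr // mulr_ge0 ?rate_ge0 // ltW. Qed.

Lemma slopeE g : 0 < g ->
  slope g ^+ 2 * (1 + d%:R * kill_rate g) = 2 * d%:R * kill_rate g.
Proof.
move=> g0; rewrite sqr_sqrtr; last first.
  by apply: divr_ge0; [rewrite mulr_ge0 ?rate_ge0|exact/ltW/denom_gt0].
by rewrite divfK // gt_eqF // denom_gt0.
Qed.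

Hypothesis b1_gt0 : 0 < b1.
Hypothesis b1_lt : b1 ^+ 2 < 2 * d%:R * ((1 - delta) * m).
Hypothesis K_large : ln 4 + b1 <= K * (b1 - c).

Lemma near_slope_ge : \forall g \near (0 : R)^'+, b1 * Num.sqrt g <= slope g.
Proof.
pose B2 := 2 * d%:R * ((1 - delta) * m).
have hb : 0 < B2 - b1 ^+ 2 by rewrite subr_gt0.
have hm : 0 <= b1 ^+ 2 * (d%:R * ((1 - delta) * m)).
  by rewrite !mulr_ge0 ?sqr_ge0 ?subr_ge0 // ltW.
near=> g.
have g0 : 0 < g by near: g; exact: nbhs_right_gt.
have hg : b1 ^+ 2 * (d%:R * ((1 - delta) * m)) * g <= B2 - b1 ^+ 2.
  by near: g; exact: near_mul_le.
rewrite -[b1]ger0_norm ?(ltW b1_gt0) // -sqrtr_sqr -sqrtrM ?sqr_ge0 //.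
apply: ler_wsqrtr; rewrite ler_pdivlMr ?denom_gt0 //.
have -> : 2 * d%:R * kill_rate g = B2 * g by rewrite /kill_rate /B2; ring.
rewrite mulrAC ler_pM2r // mulrDr mulr1.
by rewrite (_ : _ * (d%:R * kill_rate g) = b1 ^+ 2 * (d%:R * ((1 - delta) * m)) * g);
  [lra|rewrite /kill_rate; ring].
Unshelve. all: by end_near. Qed.

Lemma near_slab_width_ge1 : \forall g \near (0 : R)^'+, 1 <= slab_width g.
Proof.
near=> g.
have g0 : 0 < g by near: g; exact: nbhs_right_gt.
have s0 : 0 < Num.sqrt g by rewrite sqrtr_gt0.
rewrite /slab_width ler_pdivlMr // mul1r -[K]ger0_norm ?(ltW K_gt0) // -sqrtr_sqr.
apply: ler_wsqrtr; rewrite -[g]mul1r; near: g; apply: near_mul_le => //.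
exact: exprn_gt0.
Unshelve. all: by end_near. Qed.

(** The exponent slope (L - 1) is at least b1 K - b1, hence at least c K + ln 4 by [K_large]. Of the
    factor 4, one 2 pays for cosh >= exp / 2; the other leaves half of the bound to saturation. *)
Lemma near_decay : \forall g \near (0 : R)^'+,
  (cosh (slope g * (slab_width g - 1)))^-1 <= expR (- (c * K)) / 2.
Proof.
near=> g.
have g0 : 0 < g by near: g; exact: nbhs_right_gt.
have s0 : 0 < Num.sqrt g by rewrite sqrtr_gt0.
have L1 : 1 <= slab_width g by near: g; exact: near_slab_width_ge1.
have sl : b1 * Num.sqrt g <= slope g by near: g; exact: near_slope_ge.
have s1 : Num.sqrt g <= 1.
  rewrite -sqrtr1; apply: ler_wsqrtr; rewrite -[g]mul1r; near: g; exact: near_mul_le.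
have h : c * K + ln 4 <= slope g * (slab_width g - 1).
  apply: (@le_trans _ _ (b1 * Num.sqrt g * (slab_width g - 1))); last first.
    by apply: ler_wpM2r => //; rewrite subr_ge0.
  rewrite mulrBr mulr1 /slab_width -mulrA [_ * (K / _)]mulrC divfK ?gt_eqF //.
  have : b1 * Num.sqrt g <= b1 by rewrite -[leRHS]mulr1 ler_pM2l.
  by have := K_large; lra.
have e4 : expR (c * K) * 4 <= expR (slope g * (slab_width g - 1)).
  by rewrite -[4]lnK ?posrE // -expRD ler_expR.
have := cosh_ge_half_expR (slope g * (slab_width g - 1)).
have ec := expR_gt0 (c * K).
rewrite expRN -invfM; move=> hc; rewrite lef_pV2 ?posrE ?mulr_gt0 //.
  by lra.
exact: addr_gt0 (expR_gt0 _) (expR_gt0 _).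
Unshelve. all: by end_near. Qed.

Lemma near_saturation : \forall g \near (0 : R)^'+,
  site_fee d (slab_width g) (saturation g) * (d%:R * (slab_width g + 2) ^+ 2) <=
  expR (- (c * K)) / 2.
Proof.
(* From (N - 1) / (4 d (L + 1)) with N - 1 >= delta / (2 g M), L + 1 <= 2 L and L = K / sqrt(g): the
   exponent is at least D / sqrt(g). *)
pose D := delta / (16 * d%:R * K * M).
have D0 : 0 < D by rewrite divr_gt0 // !mulr_gt0.
(* Collects fee 2 (256 / D^4) g^2 times budget d (L + 2)^2, where (L + 2)^2 g <= 9 K^2. *)
pose C := 2 * d%:R * (9 * K ^+ 2) * (256 / D ^+ 4).
have q0 : 0 < 2 * d%:R * (256 / D ^+ 4) by rewrite !mulr_gt0 // invr_gt0 exprn_gt0.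
have C0 : 0 <= C.
  by rewrite /C mulrAC mulr_ge0 ?(ltW q0) // mulr_ge0 // sqr_ge0.
near=> g.
have g0 : 0 < g by near: g; exact: nbhs_right_gt.
have s0 : 0 < Num.sqrt g by rewrite sqrtr_gt0.
have s2 : Num.sqrt g ^+ 2 = g by rewrite sqr_sqrtr // ltW.
have L1 : 1 <= slab_width g by near: g; exact: near_slab_width_ge1.
(* Makes delta / (2 g M) at least 2, enough to absorb both the truncation in [saturation] and the
   predecessor. *)
have gM : 4 * M * g <= delta by near: g; apply: near_mul_le => //; rewrite mulr_ge0 // ltW.
have Cg : C * g <= expR (- (c * K)) / 2.
  by near: g; apply: near_mul_le => //; rewrite divr_gt0 ?expR_gt0.
apply: le_trans Cg.
set L := slab_width g in L1 *; set N := saturation g.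
have L0 : 0 < L by apply: lt_le_trans L1.
have LE : L * Num.sqrt g = K by rewrite /L /slab_width divfK // gt_eqF.
have rate0 : 0 < 4 * d%:R * (L + 1) by rewrite !mulr_gt0 // addr_gt0.
have rho_le : rho d L ^+ N.-1 <= expR (- (D / Num.sqrt g)).
  apply: (@le_trans _ _ (expR (- (4 * d%:R * (L + 1))^-1) ^+ N.-1)).
    apply: lerXn2r; rewrite ?nnegrE ?expR_ge0 ?(rho_ge0 d_gt0) //.
    exact: expR_ge1Dx.
  rewrite -expRM_natr ler_expR mulNr lerN2 [leRHS]mulrC ler_pdivlMr //.
  have gM0 : 0 < g * M by rewrite mulr_gt0.
  have N1 : delta / (2 * (g * M)) <= N.-1%:R.
    have x0 : 0 <= delta / (g * M) by rewrite divr_ge0 // ltW.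
    have /andP[_ h] := truncn_itv x0; rewrite -/(saturation g) -/N in h.
    have : N%:R <= N.-1%:R + 1 :> R by rewrite natr1 ler_nat leqSpred.
    rewrite -natr1 in h.
    have : 2 <= delta / (2 * (g * M)) by rewrite ler_pdivlMr ?mulr_gt0 //; lra.
    have e : delta / (g * M) = delta / (2 * (g * M)) * 2 by field; rewrite !gt_eqF.
    rewrite e in h; lra.
  apply: le_trans N1.
  apply: (@le_trans _ _ (D / Num.sqrt g * (4 * d%:R * (2 * L)))).
    apply: ler_wpM2l; first by rewrite divr_ge0 // ltW.
    by rewrite ler_pM2l ?mulr_gt0 //; lra.
  rewrite le_eqVlt; apply/orP; left; apply/eqP.
  rewrite -[L](mulfK (lt0r_neq0 s0)) LE /D -[in RHS]s2.
  by field; rewrite !gt_eqF.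
have fee : site_fee d L N <= 2 * (256 / D ^+ 4 * g ^+ 2).
  rewrite /site_fee ler_pM2l //; apply: (le_trans rho_le).
  apply: (le_trans (expRN_le_inv_pow4 (divr_gt0 D0 s0))).
  rewrite le_eqVlt; apply/orP; left; apply/eqP.
  rewrite expr_div_n -[in RHS]s2; field; rewrite !gt_eqF //.
have L2 : (L + 2) ^+ 2 * g <= 9 * K ^+ 2.
  have -> : 9 * K ^+ 2 = (3 * L) ^+ 2 * g by rewrite -LE exprMn s2; ring.
  rewrite ler_pM2r // ler_sqr ?nnegrE; lra.
apply: (@le_trans _ _ (2 * (256 / D ^+ 4 * g ^+ 2) * (d%:R * (L + 2) ^+ 2))).
  apply: ler_wpM2r => //; rewrite mulr_ge0 ?sqr_ge0 //; exact: ltW.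
have -> : 2 * (256 / D ^+ 4 * g ^+ 2) * (d%:R * (L + 2) ^+ 2) =
  2 * d%:R * (256 / D ^+ 4) * g * ((L + 2) ^+ 2 * g) by ring.
have -> : C * g = 2 * d%:R * (256 / D ^+ 4) * g * (9 * K ^+ 2) by rewrite /C; ring.
by apply: ler_wpM2l => //; rewrite mulr_ge0 ?(ltW q0) ?(ltW g0).
Unshelve. all: by end_near. Qed.

Lemma near_slab_factor : \forall g \near (0 : R)^'+,
  slab_factor d (saturation g) (slope g) (slab_width g) <= expR (- (c * K)).
Proof.
near=> g; rewrite /slab_factor [leRHS]splitr; apply: lerD.
- by near: g; exact: near_decay.
- by near: g; exact: near_saturation.
Unshelve. all: by end_near. Qed.

End asymptotics.

(** * Convergence *)

Lemma cvge_near_gt (R : realType) (T : Type) (F : set_system T) (f : T -> \bar R)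
    (x l : \bar R) : (f @ F --> l)%E -> (x < l)%E -> \forall t \near F, (x < f t)%E.
Proof. by move=> fl xl; have := fl _ (open_ereal_gt' xl). Qed.

Lemma truncated_mean_cvg (dO : measure_display) (Omega : measurableType dO)
    (R : realType) (P : probability Omega R) (X : Omega -> R) :
  measurable_fun setT X -> (forall w, 0 <= X w) ->
  ('E_P[fun w => Num.min (X w) n%:R] @[n --> \oo] --> 'E_P[X])%E.
Proof.
move=> mX X0; rewrite unlock.
have -> : (\int[P]_w (X w)%:E = \int[P]_w limn (fun n => (Num.min (X w) n%:R)%:E))%E.
  apply: eq_integral => w _; apply/esym/cvg_lim => //.
  apply: cvg_EFin; first exact: nearW.
  apply: cvg_near_cst; exists (Num.truncn (X w)).+1 => // n /= nX.
  by rewrite min_l // ltW // (lt_le_trans (truncnS_gt _)) // ler_nat.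
apply: cvg_monotone_convergence => //.
- by move=> n; apply/measurable_EFinP; exact: measurable_minr.
- by move=> n w _; rewrite lee_fin le_min X0 ler0n.
- by move=> w _ m n mn; rewrite lee_fin le_min !ge_min lexx ler_nat mn orbT.
Qed.

Section main.
Variables (R : realType) (d : nat) (dO dO' dW : measure_display).
Variables (Omega : measurableType dO) (P : probability Omega R).
Variables (Omega' : measurableType dO') (P' : probability Omega' R).
Variables (W : measurableType dW) (Q : probability W R).
Variable (S : nat -> W -> 'rV[int]_d).
Variables (V : R -> 'rV[int]_d -> {RV P >-> R}) (Vlim : {RV P' >-> R}).
Variables (alpha beta : R -> 'rV[R]_d -> R).
Hypothesis d_gt0 : (0 < d)%N.
Hypothesis hS : simple_random_walk Q S.
Hypothesis hV : forall g : R, 0 < g -> iid_potential (V g).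
Hypothesis hVlim : forall w, 0 <= Vlim w.
Hypothesis hdistr : cvg_in_distribution_at0 P P' (fun g w => V g 0 w / g) Vlim.
Hypothesis hmean : forall g : R, 0 < g ->
  (0 < 'E_P[V g 0%R] * (g^-1)%R%:E < +oo)%E.
Hypothesis halpha : forall g : R, 0 < g ->
  quenched_lyapunov P Q S (fun x => V g x : Omega -> R) (alpha g).
Hypothesis hbeta : forall g : R, 0 < g ->
  annealed_lyapunov P Q S (fun x => V g x : Omega -> R) (beta g).

Let d0 : 0 < d%:R :> R. Proof. by rewrite ltr0n. Qed.

Let V_ge0 g x w : 0 < g -> 0 <= V g x w. Proof. by move=> /hV[]. Qed.

Definition mean (g : R) : R := fine 'E_P[V g 0%R].

Lemma meanE g : 0 < g -> ('E_P[V g 0%R] = (mean g)%:E)%E.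
Proof.
move=> g0; rewrite fineK // ge0_fin_numE; last first.
  by apply: expectation_ge0 => w; exact: V_ge0.
have /andP[_] := hmean g0; case: ('E_P[V g 0%R])%E => [z _| |_]; [exact: ltry| |by []].
by rewrite gt0_mulye ?lte_fin ?invr_gt0.
Qed.

Lemma mean_gt0 g : 0 < g -> 0 < mean g.
Proof.
move=> g0; have /andP[+ _] := hmean g0.
by rewrite (meanE g0) -EFinM lte_fin pmulr_lgt0 // invr_gt0.
Qed.

Lemma near_truncated_mean_gt (M : nat) (t : R) :
  (t%:E < 'E_P'[fun w => Num.min (Vlim w) M%:R])%E ->
  \forall g \near 0^'+, (t%:E <= 'E_P[fun w => (Num.min (V g 0%R w / g) M%:R)%R])%E.
Proof.
(* The absolute value makes the test function bounded on the whole line; on nonnegative variables it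
   is min(u, M). *)
move=> tM; pose f (u : R) : R := Num.min `|u| M%:R.
have f_cont : continuous f.
  move=> u; apply: (@continuous_min R R (fun u => `|u|) (fun=> M%:R)).
    exact: norm_continuous.
  exact: cvg_cst.
have f_bounded : exists B : R, forall u, `|f u| <= B.
  exists M%:R => u; rewrite ger0_norm ?ge_min ?lexx ?orbT //.
  by rewrite le_min normr_ge0 ler0n.
have := hdistr f_cont f_bounded.
have -> : (f \o Vlim) = (fun w => Num.min (Vlim w) M%:R).
  by apply/funext => w; rewrite /f /= ger0_norm.
move=> /cvge_near_gt /(_ tM) ht.
near=> g.
have g0 : 0 < g by near: g; exact: nbhs_right_gt.
have -> : (fun w => Num.min (V g 0 w / g) M%:R) = f \o (fun w => V g 0 w / g).
  by apply/funext => w; rewrite /f /= ger0_norm // divr_ge0 ?V_ge0 // ltW.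
by apply: ltW; near: g.
Unshelve. all: by end_near. Qed.

(** With t = c^2 / (2d) the strict inequality leaves room for t < m' < m1 < E min(Vlim, M). The gap
    m1 - m' pays for the mesh 1/r, and delta is chosen so that (1 - delta) m' is still above t. The
    limiting slope B then exceeds c, and K is taken large in terms of the gap between c and b1. *)
Lemma near_lyapunov_ge (c : R) : 0 <= c ->
  ((c ^+ 2)%:E < (2 * d)%N%:R%:E * 'E_P'[Vlim])%E ->
  \forall g \near 0^'+, forall x,
    c * Num.sqrt g * norm2 x <= alpha g x /\ c * Num.sqrt g * norm2 x <= beta g x.
Proof.
move=> c0 cV.
have D0 : 0 < (2 * d)%N%:R :> R by rewrite ltr0n muln_gt0.
pose t := c ^+ 2 / (2 * d)%N%:R.
have t0 : 0 <= t by rewrite divr_ge0 ?sqr_ge0.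
have tV : (t%:E < 'E_P'[Vlim])%E.
  by move: cV; rewrite -lte_pdivrMl // -EFinM mulrC.
have mVlim : measurable_fun setT Vlim by exact: measurable_funPT.
have /cvge_near_gt /(_ tV) [M0 _ hM0] := @truncated_mean_cvg _ _ _ P' _ mVlim hVlim.
pose M := M0.+1.
have tM : (t%:E < 'E_P'[fun w => (Num.min (Vlim w) M%:R)%R])%E by exact: hM0 (leqnSn _).
have [m1 [tm1 m1M]] : exists m1 : R, t < m1 /\ (m1%:E < 'E_P'[fun w => (Num.min (Vlim w) M%:R)%R])%E.
  move: tM; case: ('E_P'[_])%E => [z| |] // tz.
    by exists ((t + z) / 2); rewrite lte_fin in tz; split; rewrite ?lte_fin; lra.
  by exists (t + 1); split; [lra|exact: ltry].
pose m' := (t + m1) / 2.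
have m't : t < m' by rewrite /m'; lra.
have m'0 : 0 < m' by lra.
pose r := (Num.truncn (2 / (m1 - t))).+1.
have r0 : 0 < r%:R :> R by rewrite ltr0n.
have rinv : m' + r%:R^-1 <= m1.
  have : r%:R^-1 <= (m1 - t) / 2.
    rewrite -[leRHS]invrK lef_pV2 ?posrE ?invr_gt0 ?divr_gt0 ?subr_gt0 //.
    by rewrite invf_div ltW // truncnS_gt.
  by rewrite /m'; lra.
pose delta := (m' - t) / (2 * m').
have delta0 : 0 < delta by apply: divr_gt0; lra.
have delta1 : delta < 1 by rewrite ltr_pdivrMr; lra.
have dm : (1 - delta) * m' = (m' + t) / 2 by rewrite /delta; field; rewrite gt_eqF.
pose B := Num.sqrt (2 * d%:R * ((1 - delta) * m')).
have B2 : B ^+ 2 = 2 * d%:R * ((1 - delta) * m').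
  rewrite sqr_sqrtr //; apply: mulr_ge0 => //; rewrite dm; lra.
have cB : c < B.
  rewrite -ltr_sqr ?nnegrE ?sqrtr_ge0 // B2 dm -natrM.
  by rewrite -ltr_pdivrMl // mulrC -/t; lra.
pose b1 := (c + B) / 2.
have cb1 : c < b1 by rewrite /b1; lra.
have b10 : 0 < b1 by apply: le_lt_trans cb1.
have b1B : b1 ^+ 2 < 2 * d%:R * ((1 - delta) * m').
  by rewrite -B2 ltr_sqr ?nnegrE ?sqrtr_ge0 ?(ltW b10) // /b1; lra.
have ln4 : 0 <= ln 4 :> R by apply: ln_ge0; lra.
pose K := (ln 4 + b1) / (b1 - c).
have K0 : 0 < K by rewrite divr_gt0 ?subr_gt0 //; lra.
have Klarge : ln 4 + b1 <= K * (b1 - c) by rewrite divfK // gt_eqF // subr_gt0.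
have M0' : 0 < M%:R :> R by rewrite ltr0n.
near=> g.
have g0 : 0 < g by near: g; exact: nbhs_right_gt.
have s0 : 0 < Num.sqrt g by rewrite sqrtr_gt0.
have hmean_g : (m1%:E <= 'E_P[fun w => (Num.min (V g 0%R w / g) M%:R)%R])%E.
  by near: g; exact: near_truncated_mean_gt.
have L1 : 1 <= slab_width K g by near: g; exact: near_slab_width_ge1.
have factor_le : slab_factor d (saturation M%:R delta g) (slope d m' delta g)
    (slab_width K g) <= expR (- (c * K)).
  by near: g; exact: (near_slab_factor d_gt0 m'0 M0' delta0 delta1 K0 b10 b1B Klarge).
have mean_ge : ((m' + r%:R^-1)%:E <= 'E_P[fun w => (Num.min (V g 0%R w / g) M%:R)%R])%E.
  by apply: le_trans hmean_g; rewrite lee_fin.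
have gM0 : 0 < g * M%:R by rewrite mulr_gt0.
have delta_bound : (saturation M%:R delta g)%:R * (g * M%:R) <= delta <= 1.
  rewrite (ltW delta1) andbT -ler_pdivlMr //.
  have x0 : 0 <= delta / (g * M%:R) by rewrite divr_ge0 // ltW.
  by have /andP[] := truncn_itv x0.
have cE : c * Num.sqrt g = c * K / slab_width K g.
  by rewrite /slab_width; field; rewrite !gt_eqF.
have key a : is_norm a -> (forall l, beta g (int_vec R l) <= a (int_vec R l)) ->
    forall x, c * Num.sqrt g * norm2 x <= a x.
  rewrite cE; apply: (annealed_ge_norm2 d_gt0 hS (hV g0) (meanE g0) g0 (ltn0Sn _)
    (ltW m'0) mean_ge delta_bound _ _ L1 factor_le _ (hbeta g0)).
  - exact: sqrtr_ge0.
  - exact: slopeE.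
  - by rewrite mulr_ge0 // ltW.
move=> x; split; apply: key => //.
- by case: (halpha g0).
- move=> l; apply: (annealed_le_quenched (Ordinal d_gt0, false) hS _ _ _ _ (halpha g0) (hbeta g0)).
  + by move=> z; exact: measurable_funPT.
  + by move=> z w; exact: V_ge0.
  + exact: (iid_mean (hV g0) (meanE g0)).
- by case: (hbeta g0).
Unshelve. all: by end_near. Qed.

Lemma near_quenched_le : \forall g \near (0 : R)^'+, 2 * d%:R * mean g < 1 ->
  forall x, alpha g x / Num.sqrt g <=
    Num.sqrt (2 * d%:R * (mean g / g)) / (1 - 2 * d%:R * mean g) * norm2 x.
Proof.
near=> g => mu1 x.
have g0 : 0 < g by near: g; exact: nbhs_right_gt.
have s0 : 0 < Num.sqrt g by rewrite sqrtr_gt0.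
have mu0 := mean_gt0 g0.
rewrite ler_pdivrMr // mulrAC [X in _ <= X * _](_ : _ =
  Num.sqrt (2 * d%:R * mean g) / (1 - 2 * d%:R * mean g)).
  apply: (quenched_le_norm2 d_gt0 hS _ _ _ (halpha g0)) => //.
  - by move=> z w; case: (hV g0).
  - exact: (iid_mean (hV g0) (meanE g0)).
rewrite mulrAC -sqrtrM; last by rewrite !mulr_ge0 ?invr_ge0 // ltW.
by congr (Num.sqrt _ / _); field; rewrite gt_eqF.
Unshelve. all: by end_near. Qed.

Lemma scaled_lyapunov_cvg (v : R) (f : R -> 'rV[R]_d -> R) (l : 'rV[R]_d) :
  ('E_P'[Vlim] = v%:E)%E -> mean g / g @[g --> 0^'+] --> v ->
  (forall g, 0 < g -> is_norm (f g)) ->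
  (forall c, 0 <= c -> ((c ^+ 2)%:E < (2 * d)%N%:R%:E * 'E_P'[Vlim])%E ->
    \forall g \near 0^'+, forall x, c * Num.sqrt g * norm2 x <= f g x) ->
  (forall g, 0 < g -> f g l <= alpha g l) ->
  f g l / Num.sqrt g @[g --> 0^'+] --> Num.sqrt (2 * d%:R * v) * norm2 l.
Proof.
move=> EV mv norm_f f_ge f_le.
have v0 : 0 <= v by rewrite -lee_fin -EV; exact: expectation_ge0.
set T := Num.sqrt _; have T0 : 0 <= T by exact: sqrtr_ge0.
have T2 : T ^+ 2 = 2 * d%:R * v by rewrite sqr_sqrtr // !mulr_ge0.
have g_cvg0 : (g : R) @[g --> 0^'+] --> (0 : R) by exact: cvg_at_right_filter.
have mean_cvg0 : 2 * d%:R * mean g @[g --> 0^'+] --> (0 : R).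
  have h : 2 * d%:R * (mean g / g * g) @[g --> 0^'+] --> 2 * d%:R * (v * 0).
    by apply: cvgM; [exact: cvg_cst|exact: cvgM].
  rewrite !mulr0 in h; apply: cvg_trans h; apply: near_eq_cvg.
  near=> g; rewrite divfK // gt_eqF //; near: g; exact: nbhs_right_gt.
have up_cvg : Num.sqrt (2 * d%:R * (mean g / g)) / (1 - 2 * d%:R * mean g) * norm2 l
    @[g --> 0^'+] --> T * norm2 l.
  rewrite -[T]mulr1 -[X in T * X]invr1 -[X in X^-1]subr0.
  apply: cvgM; last exact: cvg_cst.
  apply: cvgM; last first.
    apply: cvgV; first by rewrite subr0 oner_neq0.
    by apply: cvgB; [exact: cvg_cst|exact: mean_cvg0].
  apply: (@cvg_comp _ _ _ (fun g => 2 * d%:R * (mean g / g)) Num.sqrt).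
    by apply: cvgM; [exact: cvg_cst|exact: mv].
  exact: sqrt_continuous.
have lower eps : 0 < eps -> \forall g \near (0 : R)^'+, T * norm2 l - eps <= f g l / Num.sqrt g.
  move=> eps0; have n0 : 0 <= norm2 l by exact: sqrtr_ge0.
  (* If T |l| <= eps, nonnegativity suffices; otherwise the constant [c] below is positive, as the
     lower bound requires. *)
  have [small|large] := lerP (T * norm2 l) eps.
    near=> g; apply: (@le_trans _ _ 0); first by lra.
    rewrite divr_ge0 ?sqrtr_ge0 // is_norm_ge0 //; apply: norm_f.
    by near: g; exact: nbhs_right_gt.
  have n1 : 0 < norm2 l.
    by rewrite lt_def n0 andbT; apply/eqP => nl; move: large; rewrite nl mulr0; lra.
  pose c := T - eps / norm2 l.
  have cn : c * norm2 l = T * norm2 l - eps by rewrite /c mulrBl divfK // gt_eqF.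
  have c0 : 0 < c by rewrite -(pmulr_lgt0 c n1) cn; lra.
  have cT : c < T by rewrite /c gtrBl divr_gt0.
  have : ((c ^+ 2)%:E < (2 * d)%N%:R%:E * 'E_P'[Vlim])%E.
    by rewrite EV -EFinM lte_fin natrM -T2 ltr_sqr ?nnegrE // ltW.
  move=> /(f_ge _ (ltW c0)) hc.
  near=> g.
  have g0 : 0 < g by near: g; exact: nbhs_right_gt.
  have s0 : 0 < Num.sqrt g by rewrite sqrtr_gt0.
  rewrite -cn ler_pdivlMr // mulrAC.
  by near: g; apply: filterS hc => g /(_ l).
apply/cvgrPdist_le => eps eps0.
have /cvgrPdist_le /(_ _ eps0) up_near := up_cvg.
have := lower _ eps0 => low_near.
have mu_near : \forall g \near (0 : R)^'+, 2 * d%:R * mean g < 1.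
  exact: (cvgr_lt _ mean_cvg0 _ ltr01).
near=> g.
have g0 : 0 < g by near: g; exact: nbhs_right_gt.
have s0 : 0 < Num.sqrt g by rewrite sqrtr_gt0.
have h1 : T * norm2 l - eps <= f g l / Num.sqrt g by near: g; exact: low_near.
have mu1 : 2 * d%:R * mean g < 1.
  by near: g; exact: mu_near.
have h2 : `|T * norm2 l - Num.sqrt (2 * d%:R * (mean g / g)) /
    (1 - 2 * d%:R * mean g) * norm2 l| <= eps by near: g; exact: up_near.
have h3 : alpha g l / Num.sqrt g <=
    Num.sqrt (2 * d%:R * (mean g / g)) / (1 - 2 * d%:R * mean g) * norm2 l.
  have : 2 * d%:R * mean g < 1 -> forall x, alpha g x / Num.sqrt g <=
      Num.sqrt (2 * d%:R * (mean g / g)) / (1 - 2 * d%:R * mean g) * norm2 x.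
    by near: g; exact: near_quenched_le.
  exact.
have h4 : f g l / Num.sqrt g <= alpha g l / Num.sqrt g.
  by rewrite ler_pM2r ?invr_gt0 //; exact: f_le.
move: h2; rewrite !ler_norml => /andP[h5 h6]; apply/andP; split; lra.
Unshelve. all: by end_near. Qed.

(** With an infinite mean the lower bound holds for every [c] and alone forces divergence. At l = 0
    the norm vanishes, in agreement with the convention that infinity times 0 is 0. *)
Lemma scaled_lyapunov_cvgy (f : R -> 'rV[R]_d -> R) (l : 'rV[R]_d) :
  ('E_P'[Vlim] = +oo)%E ->
  (forall g, 0 < g -> is_norm (f g)) ->
  (forall c, 0 <= c -> ((c ^+ 2)%:E < (2 * d)%N%:R%:E * 'E_P'[Vlim])%E ->
    \forall g \near 0^'+, forall x, c * Num.sqrt g * norm2 x <= f g x) ->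
  ((f g l / Num.sqrt g)%:E @[g --> 0^'+] --> +oo * (norm2 l)%:E)%E.
Proof.
move=> EV norm_f f_ge.
have [n0|n0] := eqVneq (norm2 l) 0.
  rewrite n0 mule0; apply: cvg_near_cst; near=> g.
  rewrite (norm2_eq0 n0) is_norm0 ?mul0r //; apply: norm_f.
  by near: g; exact: nbhs_right_gt.
have n1 : 0 < norm2 l by rewrite lt_def n0 sqrtr_ge0.
rewrite gt0_mulye ?lte_fin //; apply/cvgeyPge => A.
pose c := `|A| / norm2 l.
have c0 : 0 <= c by rewrite divr_ge0 // ltW.
have hc := f_ge c c0; rewrite EV gt0_muley ?lte_fin ?ltr0n ?muln_gt0 // in hc.
have {}hc := hc (ltry _).
near=> g.
have g0 : 0 < g by near: g; exact: nbhs_right_gt.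
have s0 : 0 < Num.sqrt g by rewrite sqrtr_gt0.
rewrite lee_fin ler_pdivlMr //.
apply: (@le_trans _ _ (c * Num.sqrt g * norm2 l)); last first.
  by near: g; apply: filterS hc => g /(_ l).
rewrite mulrAC divfK // ler_pM2r //; exact: ler_norm.
Unshelve. all: by end_near. Qed.

End main.

Theorem theorem4 (R : realType) (d : nat) (hd : (1 <= d)%N)
  (dO dO' dW : measure_display)
  (Omega : measurableType dO) (P : probability Omega R)
  (Omega' : measurableType dO') (P' : probability Omega' R)
  (W : measurableType dW) (Q : probability W R)
  (S : nat -> W -> 'rV[int]_d) (hS : simple_random_walk Q S)
  (V : R -> 'rV[int]_d -> {RV P >-> R})
  (hV : forall gamma : R, 0 < gamma -> iid_potential (V gamma))
  (Vlim : {RV P' >-> R}) (hVlim : forall w, 0 <= Vlim w)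
  (hdistr : cvg_in_distribution_at0 P P'
    (fun gamma w => V gamma 0 w / gamma) Vlim)
  (hmean : forall gamma : R, 0 < gamma ->
    (0 < 'E_P[V gamma 0%R] * (gamma^-1)%R%:E < +oo)%E)
  (hcvg : ('E_P[V gamma 0%R] * (gamma^-1)%R%:E)%E @[gamma --> 0^'+]
            --> 'E_P'[Vlim]%E)
  (alpha beta : R -> 'rV[R]_d -> R)
  (halpha : forall gamma : R, 0 < gamma ->
    quenched_lyapunov P Q S (fun x => V gamma x : Omega -> R) (alpha gamma))
  (hbeta : forall gamma : R, 0 < gamma ->
    annealed_lyapunov P Q S (fun x => V gamma x : Omega -> R) (beta gamma)) :
  forall l : 'rV[R]_d,
    ((alpha gamma l / Num.sqrt gamma)%:E @[gamma --> 0^'+]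
       --> (sqrte ((2 * d)%N%:R%:E * 'E_P'[Vlim]) * (norm2 l)%:E)%E) /\
    ((beta gamma l / Num.sqrt gamma)%:E @[gamma --> 0^'+]
       --> (sqrte ((2 * d)%N%:R%:E * 'E_P'[Vlim]) * (norm2 l)%:E)%E).
Proof.
move=> l.
have lower : forall c, 0 <= c -> ((c ^+ 2)%:E < (2 * d)%N%:R%:E * 'E_P'[Vlim])%E ->
    \forall g \near 0^'+, forall x,
      c * Num.sqrt g * norm2 x <= alpha g x /\ c * Num.sqrt g * norm2 x <= beta g x.
  by move=> c; exact: near_lyapunov_ge hd hS hV hVlim hdistr hmean halpha hbeta c.
have lower_alpha c : 0 <= c -> ((c ^+ 2)%:E < (2 * d)%N%:R%:E * 'E_P'[Vlim])%E ->
    \forall g \near 0^'+, forall x, c * Num.sqrt g * norm2 x <= alpha g x.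
  by move=> c0 /(lower _ c0); apply: filterS => g + x => /(_ x)[].
have lower_beta c : 0 <= c -> ((c ^+ 2)%:E < (2 * d)%N%:R%:E * 'E_P'[Vlim])%E ->
    \forall g \near 0^'+, forall x, c * Num.sqrt g * norm2 x <= beta g x.
  by move=> c0 /(lower _ c0); apply: filterS => g + x => /(_ x)[].
have norm_alpha g : 0 < g -> is_norm (alpha g) by move=> /halpha[].
have norm_beta g : 0 < g -> is_norm (beta g) by move=> /hbeta[].
have beta_le g : 0 < g -> beta g l <= alpha g l.
  move=> g0; apply: is_norm_le_of_int_vec (norm_beta _ g0) (norm_alpha _ g0) _ _ => z.
  apply: (annealed_le_quenched (Ordinal hd, false) hS _ _ _ _ (halpha _ g0) (hbeta _ g0)).
  - by move=> x; exact: measurable_funPT.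
  - by move=> x w; case: (hV _ g0).
  - exact: (iid_mean (hV _ g0) (meanE hV hmean g0)).
have EV0 : (0 <= 'E_P'[Vlim])%E by exact: expectation_ge0.
case EV : ('E_P'[Vlim])%E => [v| |]; last by rewrite EV in EV0.
- have mv : mean V g / g @[g --> 0^'+] --> v.
    have := hcvg; rewrite EV => /fine_cvg; apply: cvg_trans; apply: near_eq_cvg.
    near=> g.
    have g0 : 0 < g by near: g; exact: nbhs_right_gt.
    by rewrite /= (meanE hV hmean g0).
  have -> : (sqrte ((2 * d)%N%:R%:E * v%:E) * (norm2 l)%:E =
      (Num.sqrt (2 * d%:R * v) * norm2 l)%:E)%E by rewrite -EFinM natrM.
  split; apply: cvg_EFin; try exact: nearW.
  + by apply: (scaled_lyapunov_cvg hd hS hV hVlim hmean halpha EV mv norm_alpha lower_alpha).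
  + exact: (scaled_lyapunov_cvg hd hS hV hVlim hmean halpha EV mv norm_beta lower_beta).
- have -> : sqrte ((2 * d)%N%:R%:E * +oo)%E = +oo%E :> \bar R.
    by rewrite gt0_muley // lte_fin ltr0n muln_gt0.
  split.
  + exact: scaled_lyapunov_cvgy EV norm_alpha lower_alpha.
  + exact: scaled_lyapunov_cvgy EV norm_beta lower_beta.
Unshelve. all: by end_near. Qed.
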